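(* Consider a $Q$-ary modulated Raptor code ensemble, $Q=2^q$, represented in the multi-edge framework, used on the AWGN channel and decoded with joint belief-propagation (BP) decoding of the precode and the LT code. Let $\lambda_{[i\,j]}$ ($i\ge 2$, $j\ge 1$) be the edge-perspective variable-node coefficients of the core (precode) graph, let $\rho_1(x)=\sum_{k\ge 2}\rho_k x^{k-1}$ be the edge-perspective check-node degree distribution for edge-type 1, and let $$y_2=\frac1q\sum_{i=1}^{q}x_0^{(i)},$$ where $x_0^{(i)}$ is the Bhattacharyya constant of the channel density $a_0^{(i)}$ corresponding to bit level $i$. Then the stability condition is $$\sum_{j\ge 1}\lambda_{[2\,j]}\,(y_2)^j\,\rho_1'(1)\;\le\;1 .$$ Here ''stability condition'' means a sufficient condition for convergence of the bit error rate to zero once the decoder is close to successful decoding: if the displayed inequality holds, then there is $\varepsilon>0$ such that, for every symmetric density $a_1^{(0)}$ with Bhattacharyya constant at most $\varepsilon$, the densities $a_1^{(\ell)}$ generated from $a_1^{(0)}$ by the density evolution recursion of the core graph have bit error rate tending to $0$ as $\ell\to\infty$.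
   Context: **Code ensemble.** A Raptor code is the serial concatenation of a precode (an LDPC code), which produces the ''input bits'', and an LT code, which produces the transmitted ''output bits''. In the multi-edge framework it is a multi-edge type LDPC ensemble. Edge-type 1 belongs to the precode, edge-type 2 to the LT code, and there is one further edge-type for each distinct bit-channel density, used to feed the channel output into the LT check nodes. Input bits are punctured (not transmitted) variable nodes. $L_{[i\,j]}\ge 0$ denotes the fraction (relative to the number of transmitted bits) of input-bit nodes having $i$ edges of type 1 and $j$ edges of type 2, where $i\ge 2$, $j\ge 1$. $R_{[i]}\ge 0$ denotes the fraction of precode check nodes having $i\ge 2$ edges of type 1. All these sums are finite. The core graph consists of the nodes connected to edge-type 1. Its edge-perspective distributions are $$\lambda_1(x_1,x_2)=\sum_{i\ge2}\sum_{j\ge1}\lambda_{[i\,j]}x_1^{i-1}x_2^{j},\qquad \lambda_{[i\,j]}=\frac{i\,L_{[i\,j]}}{\sum_{i',j'}i'L_{[i'\,j']}},$$ $$\rho_1(x)=\sum_{k\ge 2}\rho_k x^{k-1},\qquad \rho_k=\frac{k\,R_{[k]}}{\sum_{k'}k'R_{[k']}} .$$ Thus $\lambda_{[2\,j]}$ refers to the variable nodes of degree two in the precode. **Channel.** A $q$-tuple $a\in\{0,1\}^q$ is mapped injectively, by a Gray labelling, to a symbol $x_a$ of a constellation $\mathcal X\subset\mathbb R$ with $|\mathcal X|=2^q$. The received value is $y=x_a+$ Gaussian noise of mean $0$ and variance $\sigma^2>0$. The log-likelihood ratio (LLR) of bit $i$ is $$v_i=\log\frac{\sum_{a:\,a_i=0}p(y\mid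 x_a)}{\sum_{a:\,a_i=1}p(y\mid x_a)},\qquad p(y\mid x)=\frac{1}{\sqrt{2\pi\sigma^2}}e^{-(y-x)^2/(2\sigma^2)} .$$ Bit channels are symmetrized by i.i.d. channel adapters (a uniformly random known bit is added modulo 2 to each coded bit and undone at the receiver), so that the all-zero codeword may be assumed. Accordingly, the bit channel density $a_0^{(i)}$ of bit level $i$ is the law of $(-1)^{a_i}v_i$ when $a$ is uniform on $\{0,1\}^q$. **Densities.** Message densities are probability distributions on $(-\infty,+\infty]$ of LLRs under the all-zero codeword assumption. Such a density is symmetric if $a(-z)=e^{-z}a(z)$ (in the sense of measures on $\mathbb R$). The Bhattacharyya constant of $a$ is $\int e^{-z/2}\,a(dz)$ (with $e^{-\infty}=0$). The bit error rate of $a$ is $a(\{z<0\})+\tfrac12 a(\{z=0\})$. For independent $Z_1\sim a$, $Z_2\sim b$, the variable-node convolution $a\otimes b$ is the law of $Z_1+Z_2$, and the check-node convolution $a\boxtimes b$ is the law of $2\tanh^{-1}\!\big(\tanh(Z_1/2)\tanh(Z_2/2)\big)$. Powers $a^{\otimes n}$, $a^{\boxtimes n}$ are with respect to these operations. **Density evolution of the core graph near successful decoding.** Let $a_1^{(\ell)}$ and $b_1^{(\ell)}$ be the variable-to-check and check-to-variable densities along edge-type 1 at iteration $\ell$, and let $b_2$ be the check-to-variable density along edge-type 2. Close to successful decoding, the LT check nodes are taken to pass on the channel densities of their output bits, so $b_2$ is the average of all bit channel densities, $b_2=\frac1q\sum_{i=1}^q a_0^{(i)}$, at every iteration. The recursion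 is $$b_1^{(\ell)}=\sum_{k\ge2}\rho_k\big[a_1^{(\ell)}\big]^{\boxtimes(k-1)},\qquad a_1^{(\ell+1)}=\sum_{i\ge2}\sum_{j\ge1}\lambda_{[i\,j]}\big[b_1^{(\ell)}\big]^{\otimes(i-1)}\otimes\big[b_2\big]^{\otimes j}.$$ *)

(* Defs.v *)
From HB Require Import structures.
From mathcomp Require Import all_boot all_order all_algebra.
From mathcomp Require Import all_classical all_reals all_analysis.
From mathcomp Require Import measurable_realfun.
Import Order.TTheory GRing.Theory Num.Theory.
Import numFieldNormedType.Exports.

Set Implicit Arguments.
Unset Strict Implicit.
Unset Printing Implicit Defensive.

Local Open Scope classical_set_scope.
Local Open Scope ring_scope.

Lemma measurable_invr (R : realType) : measurable_fun setT (@GRing.inv R).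
Proof.
rewrite (_ : @GRing.inv R = fun x => x * (x ^+ 2) `^ (-1)); last first.
  apply/funext => x; rewrite powR_inv1 ?sqr_ge0// -exprVn expr2 mulrA.
  by have [->|x0] := eqVneq x 0; rewrite ?invr0 ?mulr0// mulfV// mul1r.
apply: measurable_funM => //.
exact: (measurableT_comp (f := @powR R ^~ (-1))).
Qed.

Section mixture.
Context d (T : measurableType d) (R : realType) (I : Type).
Variables (s : seq I) (w : I -> R) (P : I -> probability T R).

Definition mixture (w_ge0 : forall i, 0 <= w i)
    (w_sum1 : \sum_(i <- s) w i = 1) : set T -> \bar R :=
  fun A => (\sum_(i <- s) (w i)%:E * P i A)%E.

Variables (w_ge0 : forall i, 0 <= w i) (w_sum1 : \sum_(i <- s) w i = 1).
Local Notation mix := (mixture w_ge0 w_sum1).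

Let mixture0 : mix set0 = 0%E.
Proof. by rewrite /mixture big1// => i _; rewrite measure0 mule0. Qed.

Let mixture_ge0 A : (0 <= mix A)%E.
Proof. by apply: sume_ge0 => i _; rewrite mule_ge0// lee_fin. Qed.

Let mixture_sigma_additive : semi_sigma_additive mix.
Proof.
move=> F mF tF mUF; rewrite [X in _ --> X](_ : _ =
    limn (fun n => \sum_(0 <= i < n) mix (F i))%E).
  by apply: is_cvg_ereal_nneg_natsum => k _; exact: mixture_ge0.
rewrite nneseries_sum//; last first.
  by move=> i j _; rewrite mule_ge0// lee_fin.
apply: eq_bigr => /= i _.
exact: (@measure_semi_bigcup _ _ _ (mscale (NngNum (w_ge0 i)) (P i))).
Qed.

HB.instance Definition _ := isMeasure.Build _ _ _ mix
  mixture0 mixture_ge0 mixture_sigma_additive.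

Let mixtureT : mix setT = 1%E.
Proof.
rewrite /mixture; under eq_bigr do rewrite probability_setT mule1.
by rewrite sumEFin w_sum1.
Qed.

HB.instance Definition _ := Measure_isProbability.Build _ _ _ mix mixtureT.

End mixture.

Section uniform_mixture.
Context d (T : measurableType d) (R : realType) (I : finType).

Lemma uniform_weight_ge0 (i : I) : 0 <= #|I|%:R^-1 :> R.
Proof. by rewrite invr_ge0. Qed.

Lemma uniform_weight_sum1 :
  (0 < #|I|)%N -> \sum_(i <- index_enum I) #|I|%:R^-1 = 1 :> R.
Proof.
by move=> I0; rewrite sumr_const -[_ *+ _]mulr_natl mulfV// pnatr_eq0 -lt0n.
Qed.

Definition uniform_mixture (I0 : (0 < #|I|)%N) (P : I -> probability T R) :
    probability T R :=
  mixture P uniform_weight_ge0 (uniform_weight_sum1 I0).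

End uniform_mixture.

(* A message density on ]-oo, +oo] is a probability measure on \bar R that
   does not charge -oo ([is_density]); the values that the functions on LLRs
   take at -oo are therefore irrelevant. *)
Section densities.
Context {R : realType}.
Implicit Types (a b : probability (\bar R) R) (z : \bar R).

Definition is_density a := a [set -oo%E] = 0%E.

Definition symmetric_density a := forall A : set R, measurable A ->
  a [set (- z)%:E | z in A] = (\int[a]_(z in EFin @` A) expeR (- z))%E.

Definition bhattacharyya a : \bar R := (\int[a]_z expeR (- (z * 2^-1%:E)))%E.

Definition bit_error_rate a : \bar R :=
  (a [set z | z < 0] + 2^-1%:E * a [set 0])%E.

Definition tanh (x : R) : R :=
  (expR x - expR (- x)) / (expR x + expR (- x)).

Definition atanh (x : R) : R := ln ((1 + x) / (1 - x)) / 2.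

Definition etanh z : R :=
  match z with x%:E => tanh x | +oo%E => 1 | -oo%E => -1 end.

Definition eatanh (x : R) : \bar R :=
  if x == 1 then +oo%E else if x == -1 then -oo%E else (atanh x)%:E.

Definition var_llr (z : \bar R * \bar R) : \bar R := (z.1 + z.2)%E.

Definition chk_llr (z : \bar R * \bar R) : \bar R :=
  (2%:E * eatanh (etanh (z.1 * 2^-1%:E)%E * etanh (z.2 * 2^-1%:E)%E))%E.

Lemma measurable_var_llr : measurable_fun setT var_llr.
Proof. exact: emeasurable_funD. Qed.

HB.instance Definition _ :=
  isMeasurableFun.Build _ _ _ _ var_llr measurable_var_llr.

Lemma measurable_tanh : measurable_fun setT tanh.
Proof.
have mN : measurable_fun setT (fun x : R => expR (- x)).
  exact: measurableT_comp.
apply: measurable_funM; first exact: measurable_funB.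
apply: (measurableT_comp (f := @GRing.inv R)); first exact: measurable_invr.
exact: measurable_funD.
Qed.

Lemma measurable_etanh : measurable_fun setT etanh.
Proof.
rewrite (_ : etanh = fun z => if z == +oo%E then 1 else
    if z == -oo%E then -1 else tanh (fine z)); last first.
  by apply/funext => -[].
apply: measurable_fun_ifT => //.
  apply: (measurable_fun_bool true).
  rewrite setTI [X in measurable X](_ : _ = [set +oo%E])//.
  by apply/seteqP; split => z /eqP.
apply: measurable_fun_ifT => //.
  apply: (measurable_fun_bool true).
  rewrite setTI [X in measurable X](_ : _ = [set -oo%E])//.
  by apply/seteqP; split => z /eqP.
apply: measurableT_comp => //; exact: measurable_tanh.
Qed.

Lemma measurable_atanh : measurable_fun setT atanh.
Proof.
apply: measurable_funM => //; apply: measurableT_comp => //.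
apply: measurable_funM; first exact: measurable_funD.
apply: (measurableT_comp (f := @GRing.inv R)); first exact: measurable_invr.
exact: measurable_funB.
Qed.

Lemma measurable_eatanh : measurable_fun setT eatanh.
Proof.
have me c : measurable_fun setT (fun x : R => x == c).
  exact: measurable_fun_eqr.
apply: measurable_fun_ifT => //; apply: measurable_fun_ifT => //.
by apply/measurable_EFinP; exact: measurable_atanh.
Qed.

Lemma measurable_chk_llr : measurable_fun setT chk_llr.
Proof.
apply: emeasurable_funM => //.
apply: measurableT_comp; first exact: measurable_eatanh.
by apply: measurable_funM; apply: measurableT_comp;
  [exact: measurable_etanh|exact: emeasurable_funM
  |exact: measurable_etanh|exact: emeasurable_funM].
Qed.

HB.instance Definition _ :=
  isMeasurableFun.Build _ _ _ _ chk_llr measurable_chk_llr.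

Definition var_conv a b : probability (\bar R) R :=
  distribution (a \x b)%E var_llr.

Definition chk_conv a b : probability (\bar R) R :=
  distribution (a \x b)%E chk_llr.

(* The laws of the LLR 0 and +oo are the units of the two convolutions. *)
Definition var_pow a n : probability (\bar R) R :=
  iter n (var_conv a) (dirac 0%E).

Definition chk_pow a n : probability (\bar R) R :=
  iter n (chk_conv a) (dirac +oo%E).

End densities.

Section channel.
Context {R : realType}.

Definition gray_labelling q (x : q.-tuple bool -> R) :=
  forall a b, x a < x b -> (forall c, ~~ (x a < x c < x b)) ->
    #|[set i | tnth a i != tnth b i]%SET| = 1%N.

(* The constellation is the range of [symb]; two labels are neighbours when no
   symbol lies strictly between theirs. *)
Record modulated_awgn := ModulatedAwgn {
  q : nat;
  q_gt0 : (0 < q)%N;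
  symb : q.-tuple bool -> R;
  symb_inj : injective symb;
  symb_gray : gray_labelling symb;
  sigma : R;
  sigma_gt0 : 0 < sigma }.

Variable C : modulated_awgn.
Implicit Types (i : 'I_(q C)) (a : (q C).-tuple bool).

Definition likelihood a (y : R) : R := normal_pdf (symb a) (sigma C) y.

Definition bit_llr i (y : R) : R :=
  ln ((\sum_(a | ~~ tnth a i) likelihood a y)
      / (\sum_(a | tnth a i) likelihood a y)).

Definition adapted_llr i a (y : measurableTypeR R) : \bar R :=
  ((-1) ^+ tnth a i * bit_llr i y)%:E.

Lemma measurable_adapted_llr i a : measurable_fun setT (adapted_llr i a).
Proof.
apply/measurable_EFinP; apply: measurable_funM => //.
apply: measurableT_comp => //; apply: measurable_funM.
  under eq_fun do rewrite big_mkcond.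
  by apply: measurable_sum => b; case: (tnth b i) => //=; exact: measurable_normal_pdf.
apply: (measurableT_comp (f := @GRing.inv R)); first exact: measurable_invr.
under eq_fun do rewrite big_mkcond.
by apply: measurable_sum => b; case: (tnth b i) => //=; exact: measurable_normal_pdf.
Qed.

HB.instance Definition _ i a := isMeasurableFun.Build _ _ _ _
  (adapted_llr i a) (measurable_adapted_llr i a).

Lemma card_labels_gt0 : (0 < #|{: (q C).-tuple bool}|)%N.
Proof. by rewrite card_tuple card_bool expn_gt0. Qed.

Lemma card_levels_gt0 : (0 < #|'I_(q C)|)%N.
Proof. by rewrite card_ord q_gt0. Qed.

Definition bit_channel i : probability (\bar R) R :=
  uniform_mixture card_labels_gt0
    (fun a => distribution (normal_prob (symb a) (sigma C)) (adapted_llr i a)).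

Definition mean_bit_channel : probability (\bar R) R :=
  uniform_mixture card_levels_gt0 bit_channel.

Definition mean_bhattacharyya : \bar R :=
  ((q C)%:R^-1%:E * \sum_(i < q C) bhattacharyya (bit_channel i))%E.

End channel.

Section core.
Context {R : realType}.

(* [var_frac i j] is L_[i j] and [chk_frac k] is R_[k], extended by zero
   outside the finite range of admissible degrees.
   Only the edge-perspective ratios matter below, so no normalization of the
   node fractions is imposed beyond their nonnegativity; the two positivity
   fields are what makes these ratios meaningful. *)
Record core_ensemble := CoreEnsemble {
  imax : nat;
  jmax : nat;
  kmax : nat;
  var_frac : nat -> nat -> R;
  chk_frac : nat -> R;
  var_frac_ge0 : forall i j, 0 <= var_frac i j;
  chk_frac_ge0 : forall k, 0 <= chk_frac k;
  var_frac_supp : forall i j,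
    var_frac i j != 0 -> (2 <= i <= imax)%N && (1 <= j <= jmax)%N;
  chk_frac_supp : forall k, chk_frac k != 0 -> (2 <= k <= kmax)%N;
  var_edges_gt0 :
    0 < \sum_(2 <= i < imax.+1) \sum_(1 <= j < jmax.+1) i%:R * var_frac i j;
  chk_edges_gt0 : 0 < \sum_(2 <= k < kmax.+1) k%:R * chk_frac k }.

Variable E : core_ensemble.

Definition lambda i j : R := i%:R * var_frac E i j /
  \sum_(2 <= i' < (imax E).+1) \sum_(1 <= j' < (jmax E).+1)
    i'%:R * var_frac E i' j'.

Definition rho k : R := k%:R * chk_frac E k /
  \sum_(2 <= k' < (kmax E).+1) k'%:R * chk_frac E k'.

Definition rho1 : {poly R} :=
  \sum_(2 <= k < (kmax E).+1) rho k *: 'X^(k.-1).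

Definition var_degrees : seq (nat * nat) :=
  [seq (i, j) | i <- index_iota 2 (imax E).+1, j <- index_iota 1 (jmax E).+1].

Definition chk_degrees : seq nat := index_iota 2 (kmax E).+1.

Lemma lambda_ge0 (ij : nat * nat) : 0 <= lambda ij.1 ij.2.
Proof.
by rewrite divr_ge0 ?mulr_ge0 ?var_frac_ge0// ltW// var_edges_gt0.
Qed.

Lemma lambda_sum1 : \sum_(ij <- var_degrees) lambda ij.1 ij.2 = 1.
Proof.
rewrite big_allpairs /=; under eq_bigr do rewrite -mulr_suml.
by rewrite -mulr_suml divff// gt_eqF// var_edges_gt0.
Qed.

Lemma rho_ge0 k : 0 <= rho k.
Proof.
by rewrite divr_ge0 ?mulr_ge0 ?chk_frac_ge0// ltW// chk_edges_gt0.
Qed.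

Lemma rho_sum1 : \sum_(k <- chk_degrees) rho k = 1.
Proof. by rewrite -mulr_suml divff// gt_eqF// chk_edges_gt0. Qed.

Definition chk_update (a : probability (\bar R) R) : probability (\bar R) R :=
  mixture (fun k => chk_pow a k.-1) rho_ge0 rho_sum1.

Definition var_update (b1 b2 : probability (\bar R) R) :
    probability (\bar R) R :=
  mixture (fun ij => var_conv (var_pow b1 ij.1.-1) (var_pow b2 ij.2))
    lambda_ge0 lambda_sum1.

(* Close to successful decoding the incoming LT density [b2] is the same at
   every iteration; [a] is the variable-to-check density at iteration 0. *)
Definition core_density_evolution (b2 a : probability (\bar R) R) (l : nat) :
    probability (\bar R) R :=
  iter l (fun a' => var_update (chk_update a') b2) a.

End core.

(* Main.v *)
(* Tilting a symmetric density by e^(-z/2) gives an even measure whose mass is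
   the Bhattacharyya constant; variable nodes convolve tilted measures and check
   nodes are subadditive for the mass.  Hence the masses x_l of the a_1^(l)
   satisfy x_(l+1) <= S x_l + O(x_l^2), where S is the left-hand side of the
   stability condition, which settles S < 1.

   When S = 1, the mass of b_2 is below 1, so some check node has degree at
   least 3.  Such a node gains at least a multiple of x_l^3 / v_l over
   subadditivity, where v_l is the integral of sech^2(z/2), and it remains to
   make v_l / x_l small in order to beat the quadratic terms.  To first order
   the recursion convolves the tilted measure with powers of the tilted b_2,
   which spread out because b_2 is not the unit mass at 0; and v is subadditive
   at check nodes, even after a convolution at a variable node.  So
   v_(l+n) <= delta x_l + O(x_l^2) for a large fixed n, and x_(l+n+1) is at most
   x_(l+n) - K x_(l+n)^2 or (3/4) x_l. *)

From HB Require Import structures.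
Require Import Defs.
From mathcomp Require Import all_boot all_order all_algebra.
From mathcomp Require Import all_classical all_reals all_analysis.
From mathcomp Require Import measurable_realfun.
From mathcomp Require Import ring lra zify.
Import Order.TTheory GRing.Theory Num.Theory.
Import numFieldNormedType.Exports.

Set Implicit Arguments.
Unset Strict Implicit.
Unset Printing Implicit Defensive.

Local Open Scope classical_set_scope.
Local Open Scope ring_scope.

(** * Integration against mixtures and densities *)

(** When S = 1, the gain at check nodes and the loss at variable nodes of degree at least 3 are both
    of order x^2, and nothing in the ensemble compares their constants. This is why v / x has to be
    arbitrarily small, and not merely bounded by 1, which is automatic. The spreading produced by
    the tilted b_2 must survive the check update that follows it. The estimates of v are therefore
    proved for [mmse (var_conv a c)] with any symmetric [c]: the kernel [chord] of this quantity is
    subadditive at check nodes for each fixed value of its second argument. Spreading is needed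
    uniformly over translations, and [b] may be lattice or without moments. Dividing the powers by
    y^m turns convolution into averaging, so suprema can only decrease; a positive limit would
    create more separated near-maxima than a summable kernel allows. Finally, v_(l+n) is estimated
    by x_l and not by x_(l+n). This is useless when x has dropped a lot during the n iterations, but
    such a drop is itself progress; hence the two alternatives of the final recursion. *)

Lemma ge0_integral_mixture d (T : measurableType d) (R : realType) (I : Type)
    (s : seq I) (w : I -> R) (P : I -> probability T R)
    (w_ge0 : forall i, 0 <= w i) (w_sum1 : \sum_(i <- s) w i = 1)
    (f : T -> \bar R) : measurable_fun setT f -> (forall x, 0 <= f x)%E ->
  (\int[mixture P w_ge0 w_sum1]_x f x = \sum_(i <- s) (w i)%:E * \int[P i]_x f x)%E.
Proof.
move=> mf f0; case: s w_sum1 => [|i0 s] w_sum1.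
  by exfalso; move: w_sum1; rewrite big_nil => /esym/eqP; rewrite oner_eq0.
(* The list is not empty since the weights sum to 1, so [i0] can serve as default for [nth], and the
   mixture is a finite sum of scaled measures. *)
pose m k := mscale (NngNum (w_ge0 (nth i0 (i0 :: s) k))) (P (nth i0 (i0 :: s) k)).
rewrite (@eq_measure_integral _ _ _ _ (msum m (size (i0 :: s)))); last first.
  by move=> A _ _; rewrite /= /mixture /msum (big_nth i0) big_mkord.
rewrite ge0_integral_measure_sum// [RHS](big_nth i0) big_mkord.
by apply: eq_bigr => k _; rewrite ge0_integral_mscale.
Qed.

Section density.
Context d (T : measurableType d) (R : realType).
Variables (mu nu : {measure set T -> \bar R}) (h : T -> R).
Hypothesis mh : measurable_fun setT h.
Hypothesis h0 : forall x, 0 <= h x.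
Hypothesis muE : forall A, measurable A -> mu A = (\int[nu]_(x in A) (h x)%:E)%E.

Import HBNNSimple.

Let ge0_integral_density_nnsfun (f : {nnsfun T >-> R}) :
  (\int[mu]_x (f x)%:E = \int[nu]_x ((f x)%:E * (h x)%:E))%E.
Proof.
have mfr (r : R) : measurable (f @^-1` [set r]) by [].
under eq_integral do rewrite fimfunE -fsumEFin//.
under [in RHS]eq_integral => x _.
  rewrite fimfunE -fsumEFin// ge0_mule_fsuml; last first.
    by move=> r; rewrite EFinM nnfun_muleindic_ge0.
  over.
rewrite !ge0_integral_fsum//; last 3 first.
- move=> r x _; apply: mule_ge0; last by rewrite lee_fin.
  by rewrite EFinM nnfun_muleindic_ge0.
- by move=> r; apply/measurable_EFinP; exact: measurable_funM.
- by move=> r x _; rewrite EFinM nnfun_muleindic_ge0.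
apply: eq_fsbigr => r.
rewrite inE => -[x _ <-].
under eq_integral do rewrite EFinM.
rewrite ge0_integralZl//=; last 2 first.
- exact/measurable_EFinP.
- by rewrite lee_fin.
under [in RHS]eq_integral do rewrite EFinM -muleA.
rewrite ge0_integralZl//=; last 3 first.
- by apply/measurable_EFinP; apply: measurable_funM.
- by move=> z _; rewrite mule_ge0// lee_fin.
- by rewrite lee_fin.
congr (_ * _)%E; rewrite integral_indic// setIT muE// integral_mkcond.
apply: eq_integral => z _; rewrite /patch indicE.
by case: ifP => _; rewrite ?mul1e ?mul0e.
by move=> r; apply: emeasurable_funM; apply/measurable_EFinP => //; exact: measurable_funM.
Qed.

(** Simple functions reduce to the hypothesis [muE]; monotone convergence on both sides does the
    rest. *)
Lemma ge0_integral_density (f : T -> \bar R) :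
    measurable_fun setT f -> (forall x, 0 <= f x)%E ->
  (\int[mu]_x f x = \int[nu]_x (f x * (h x)%:E))%E.
Proof.
move=> mf f0; pose f_ := nnsfun_approx measurableT mf.
have cvf x : (EFin \o f_ ^~ x) @ \oo --> f x by exact: cvg_nnsfun_approx.
have mfn n : measurable_fun setT (fun x => (f_ n x)%:E).
  by apply/measurable_EFinP.
transitivity (limn (fun n => \int[mu]_x (f_ n x)%:E)%E).
  rewrite -monotone_convergence//.
  - by apply: eq_integral => x _; apply/esym/cvg_lim => //; exact: cvf.
  - by move=> n x _; rewrite lee_fin; exact: fun_ge0.
  - by move=> x _ a b ab; rewrite lee_fin; exact/lefP/nd_nnsfun_approx.
under eq_fun do rewrite ge0_integral_density_nnsfun.
rewrite -monotone_convergence//.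
- apply: eq_integral => x _; apply/cvg_lim => //.
  by apply: cvgeZr => //; exact: cvf.
- by move=> n; apply: emeasurable_funM => //; exact/measurable_EFinP.
- by move=> n x _; rewrite mule_ge0 ?lee_fin//; exact: fun_ge0.
- move=> x _ a b ab; rewrite lee_wpmul2r ?lee_fin//.
  exact/lefP/nd_nnsfun_approx.
Qed.

End density.

(** * Functions of a log-likelihood ratio *)

Section llr.
Context {R : realType}.
Implicit Types (z w : \bar R).

(** tanh(z/2), the coordinate in which check nodes multiply. *)
Definition thalf z : R := etanh (z * 2^-1%:E).

(** 1 / cosh(z/2), with half the argument. The value 0 at both infinities makes
    [sech z ^+ 2 = 1 - thalf z ^+ 2] hold on all of [\bar R]. *)
Definition sech z : R :=
  if z is r%:E then 2 / (expR (r / 2) + expR (- (r / 2))) else 0.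

(* The value 0 at both infinities makes [tilt] multiplicative everywhere on
   [\bar R]. *)
Definition tilt z : R := if z is r%:E then expR (- (r / 2)) else 0.

Lemma measurable_case_ereal d (T : measurableType d) (g : R -> T) (c1 c2 : T) :
  measurable_fun setT g -> measurable_fun setT (fun z =>
    match z with r%:E => g r | +oo%E => c1 | -oo%E => c2 end).
Proof.
move=> mg; rewrite (_ : (fun z => _) = fun z => if z == +oo%E then c1 else
    if z == -oo%E then c2 else g (fine z)); last by apply/funext => -[].
apply: measurable_fun_ifT => //.
  apply: (measurable_fun_bool true).
  rewrite setTI [X in measurable X](_ : _ = [set +oo%E])//.
  by apply/seteqP; split => z /eqP.
apply: measurable_fun_ifT => //.
  apply: (measurable_fun_bool true).
  rewrite setTI [X in measurable X](_ : _ = [set -oo%E])//.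
  by apply/seteqP; split => z /eqP.
exact: measurableT_comp.
Qed.

Lemma measurable_thalf : measurable_fun setT thalf.
Proof.
apply: measurableT_comp; first exact: measurable_etanh.
exact: emeasurable_funM.
Qed.

Lemma measurable_sech : measurable_fun setT sech.
Proof.
rewrite (_ : sech = fun z => match z with
    r%:E => 2 / (expR (r / 2) + expR (- (r / 2))) | +oo%E => 0 | -oo%E => 0 end);
  last by apply/funext => -[].
apply: measurable_case_ereal; apply: measurable_funM => //.
apply: (measurableT_comp (f := @GRing.inv R)); first exact: measurable_invr.
by apply: measurable_funD; apply: measurableT_comp => //;
  [|apply: measurableT_comp => //]; exact: measurable_funM.
Qed.

Lemma measurable_tilt : measurable_fun setT tilt.
Proof.
rewrite (_ : tilt = fun z => match z with
    r%:E => expR (- (r / 2)) | +oo%E => 0 | -oo%E => 0 end);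
  last by apply/funext => -[].
apply: measurable_case_ereal; apply: measurableT_comp => //.
by apply: measurableT_comp => //; exact: measurable_funM.
Qed.

Lemma sech_ge0 z : 0 <= sech z.
Proof. by case: z => //= r; rewrite divr_ge0// addr_ge0// expR_ge0. Qed.

Lemma tilt_ge0 z : 0 <= tilt z.
Proof. by case: z => //= r; exact: expR_ge0. Qed.

Lemma sechN z : sech (- z)%E = sech z.
Proof. by case: z => //= r; rewrite mulNr opprK addrC. Qed.

Lemma thalfy : thalf +oo%E = 1.
Proof. by rewrite /thalf gt0_mulye// lte_fin. Qed.

Lemma thalfNy : thalf -oo%E = -1.
Proof. by rewrite /thalf gt0_mulNye// lte_fin. Qed.

Lemma thalf_fin r : thalf r%:E =
  (expR (r / 2) - expR (- (r / 2))) / (expR (r / 2) + expR (- (r / 2))).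
Proof. by []. Qed.

Lemma thalfN z : thalf (- z)%E = - thalf z.
Proof.
case: z => [r| |] /=; last 2 first.
- by rewrite thalfy thalfNy.
- by rewrite thalfy thalfNy opprK.
by rewrite !thalf_fin mulNr opprK -[RHS]mulNr opprB [X in _ / X]addrC.
Qed.

(* with q = e^(r/2), every function of a finite LLR r is rational in q *)
Lemma sechE r : let q := expR (r / 2) in sech r%:E = 2 * q / (q ^+ 2 + 1).
Proof.
have := expR_gt0 (r / 2); rewrite /= expRN; set q := expR _ => q0.
by field; rewrite !gt_eqF//; nra.
Qed.

Lemma thalfE r : let q := expR (r / 2) in thalf r%:E = (q ^+ 2 - 1) / (q ^+ 2 + 1).
Proof.
have := expR_gt0 (r / 2); rewrite thalf_fin /= expRN; set q := expR _ => q0.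
by field; rewrite !gt_eqF//; nra.
Qed.

Lemma tiltE r : tilt r%:E = (expR (r / 2))^-1.
Proof. by rewrite /= expRN. Qed.

Lemma sech_le1 z : sech z <= 1.
Proof.
case: z => [r| |] //; rewrite sechE /=; have := expR_gt0 (r / 2).
set q := expR _ => q0; rewrite ler_pdivrMr; last nra.
by have := sqr_ge0 (q - 1); nra.
Qed.

Lemma sech_thalf z : sech z ^+ 2 = 1 - thalf z ^+ 2.
Proof.
case: z => [r| |]; last 2 first.
- by rewrite thalfy /= expr0n expr1n subrr.
- by rewrite thalfNy /= expr0n sqrrN expr1n subrr.
rewrite sechE thalfE /=; have := expR_gt0 (r / 2); set q := expR _ => q0.
by field; rewrite gt_eqF//; nra.
Qed.

Lemma thalf_bound z : -1 <= thalf z <= 1.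
Proof.
have : 0 <= 1 - thalf z ^+ 2 by rewrite -sech_thalf sqr_ge0.
by move=> h; apply/andP; split; nra.
Qed.

(** (1 + tanh(z/2)) / 2 is the logistic weight 1 / (1 + e^(-z)); multiplied by e^(-z/2) it becomes
    even in z. This is the reason why tilting a symmetric density gives an even measure. *)
Lemma thalf_tilt z : (1 + thalf z) / 2 * tilt z = sech z / 2.
Proof.
case: z => [r| |]; last 2 first.
- by rewrite /= mulr0 mul0r.
- by rewrite /= mulr0 mul0r.
rewrite sechE thalfE tiltE /=; have := expR_gt0 (r / 2); set q := expR _ => q0.
by field; rewrite !gt_eqF//; nra.
Qed.

Lemma tiltD z w : tilt (z + w)%E = tilt z * tilt w.
Proof.
case: z w => [r| |] [s| |]; rewrite /= ?mul0r ?mulr0//.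
by rewrite -expRD mulrDl opprD.
Qed.

Lemma fin_thalf_add r s (q := expR (r / 2)) (p := expR (s / 2)) :
  thalf (r%:E + s%:E) = ((q * p) ^+ 2 - 1) / ((q * p) ^+ 2 + 1).
Proof. by rewrite -EFinD thalfE /= /q /p -expRD -mulrDl. Qed.

Lemma chk_llr_thalf z w : thalf (chk_llr (z, w)) = thalf z * thalf w.
Proof.
rewrite /chk_llr /= -/(thalf z) -/(thalf w).
have := thalf_bound z; have := thalf_bound w.
move: (thalf z) (thalf w) => t s /andP[t1 t2] /andP[s1 s2].
have ts1 : -1 <= t * s by nra.
have ts2 : t * s <= 1 by nra.
(* The products 1 and -1 are the two special branches of [eatanh]; elsewhere the product lies
   strictly between them and the logarithm is finite. *)
rewrite /eatanh; case: eqVneq => [->|n1].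
  by rewrite gt0_muley ?lte_fin// thalfy.
case: eqVneq => [->|n2].
  by rewrite gt0_muleNy ?lte_fin// thalfNy.
rewrite /atanh; set x := t * s in ts1 ts2 n1 n2 *.
have x1 : x < 1 by rewrite lt_neqAle n1.
have x2 : -1 < x by rewrite lt_neqAle eq_sym n2.
rewrite -EFinM thalfE /=.
have -> : 2 * (ln ((1 + x) / (1 - x)) / 2) / 2 = ln ((1 + x) / (1 - x)) / 2.
  by field.
have -> : expR (ln ((1 + x) / (1 - x)) / 2) ^+ 2 = (1 + x) / (1 - x).
  rewrite expr2 -expRD -splitr lnK// posrE divr_gt0//; lra.
field; rewrite subr_eq0 eq_sym n1 /=.
by rewrite (_ : 1 + x + (1 - x) = 2)//; ring.
Qed.

(** Identities between values of [chk_llr] are checked after [thalf], where they become identities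
    between products. *)
Lemma thalf_inj : injective thalf.
Proof.
have lt r s : r < s -> thalf r%:E < thalf s%:E.
  move=> rs; rewrite !thalfE /=.
  have : expR (r / 2) < expR (s / 2) by rewrite ltr_expR; lra.
  have := expR_gt0 (r / 2); move: (expR (r / 2)) (expR (s / 2)) => q p q0 qp.
  rewrite ltr_pdivrMr; last nra.
  by rewrite mulrAC ltr_pdivlMr; nra.
have E r s : thalf r%:E = thalf s%:E -> r%:E = s%:E.
  by case: (ltgtP r s) => [/lt|/lt|->//] + h; rewrite h ltxx.
have B r : thalf r%:E < 1.
  rewrite thalfE /=; have := expR_gt0 (r / 2); set q := expR _ => q0.
  by rewrite ltr_pdivrMr; nra.
have B' r : -1 < thalf r%:E.
  rewrite thalfE /=; have := expR_gt0 (r / 2); set q := expR _ => q0.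
  by rewrite ltr_pdivlMr; nra.
move=> [r| |] [s| |] //; first exact: E.
all: rewrite ?thalfy ?thalfNy.
- by move=> h; have := B r; rewrite h ltxx.
- by move=> h; have := B' r; rewrite h ltxx.
- by move=> h; have := B s; rewrite h ltxx.
- by move=> h; exfalso; move: h; lra.
- by move=> h; have := B' s; rewrite h ltxx.
- by move=> h; exfalso; move: h; lra.
Qed.

Lemma chk_llrC z w : chk_llr (z, w) = chk_llr (w, z).
Proof. by apply: thalf_inj; rewrite !chk_llr_thalf mulrC. Qed.

Lemma chk_llrN z w : chk_llr ((- z)%E, w) = (- chk_llr (z, w))%E.
Proof. by apply: thalf_inj; rewrite thalfN !chk_llr_thalf thalfN mulNr. Qed.

Lemma sech_chk z w :
  sech (chk_llr (z, w)) ^+ 2 = sech z ^+ 2 + sech w ^+ 2 - sech z ^+ 2 * sech w ^+ 2.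
Proof. by rewrite !sech_thalf chk_llr_thalf; ring. Qed.

End llr.

(** * Symmetrization over a pair {z, -z} *)

Section symmetrization.
Context {R : realType}.
Implicit Types (z w : \bar R) (f : \bar R -> R).

(** Addition theorem of tanh, with its denominator cleared. *)
Lemma thalfD (r s : R) : let t := thalf r%:E in let t' := thalf s%:E in
  thalf (r%:E + s%:E)%E * (1 + t * t') = t + t'.
Proof.
rewrite /= fin_thalf_add !thalfE /=.
have := expR_gt0 (r / 2); have := expR_gt0 (s / 2).
set q := expR (r / 2); set p := expR (s / 2) => p0 q0.
have q2 : 0 < q ^+ 2 + 1 by nra.
have p2 : 0 < p ^+ 2 + 1 by nra.
have pq2 : 0 < (q * p) ^+ 2 + 1 by nra.
by field; rewrite !gt_eqF.
Qed.

(** The conditional expectation of [f] given the pair {z, -z}, the same for every symmetric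
    density. *)
Definition symz f z : R :=
  (1 + thalf z) / 2 * f z + (1 - thalf z) / 2 * f (- z)%E.

Lemma measurable_symz f : measurable_fun setT f -> measurable_fun setT (symz f).
Proof.
move=> mf; apply: measurable_funD; apply: measurable_funM => //.
- by apply: measurable_funM => //; apply: measurable_funD => //; exact: measurable_thalf.
- by apply: measurable_funM => //; apply: measurable_funB => //; exact: measurable_thalf.
- by apply: measurableT_comp => //.
Qed.

Lemma symz_ge0 f : (forall z, 0 <= f z) -> forall z, 0 <= symz f z.
Proof.
move=> f0 z; have /andP[t1 t2] := thalf_bound z.
by rewrite addr_ge0// mulr_ge0//; lra.
Qed.

Lemma symz_tilt f z :
  symz (fun z => tilt z * f z) z = sech z * ((f z + f (- z)%E) / 2).
Proof.
rewrite /symz !mulrA thalf_tilt.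
have := thalf_tilt (- z)%E; rewrite thalfN sechN => ->.
by field.
Qed.

Lemma symz_chk f z w :
  symz (fun z' => symz (fun w' => f (chk_llr (z', w'))) w) z =
  symz f (chk_llr (z, w)).
Proof.
have chkNr x y : chk_llr (x, (- y)%E) = (- chk_llr (x, y))%E.
  by rewrite chk_llrC chk_llrN chk_llrC.
rewrite /symz chk_llr_thalf !chkNr !chk_llrN !oppeK.
by field.
Qed.

(** Of the four sign patterns, two give the pair of z + w and -(z + w), with total weight (1 + t t')
    / 2, and two the pair of z - w and its opposite, with total weight (1 - t t') / 2. By the
    addition theorem each pair is already split in the proportion that [symz] prescribes. *)
Lemma symz_var f z w :
  symz (fun z' => symz (fun w' => symz f (z' + w')%E) w) z =
  symz (fun z' => symz (fun w' => f (z' + w')%E) w) z.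
Proof.
rewrite /symz.
case: z w => [r| |] [s| |]; last 8 first;
  try by rewrite /= ?thalfy ?thalfNy; field.
have tD := thalfD r s.
have tB := thalfD r (- s).
have tBC : (- r%:E + s%:E = - (r%:E - s%:E))%E.
  by congr (_%:E); ring.
have tN : (- r%:E - s%:E = - (r%:E + s%:E))%E.
  by congr (_%:E); ring.
rewrite tBC tN !oppeK !thalfN.
rewrite /= EFinN thalfN in tB.
move: tB tD => /=.
set t := thalf r%:E; set t' := thalf s%:E; set S := (r%:E + s%:E)%E.
set D := (r%:E - s%:E)%E => tB tD.
have eS : (1 + t * t') * thalf S = t + t' by rewrite -tD; ring.
have eD : (1 - t * t') * thalf D = t - t' by rewrite -tB; ring.
transitivity (((1 + t * t') + (1 + t * t') * thalf S) / 4 * f S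
  + ((1 + t * t') - (1 + t * t') * thalf S) / 4 * f (- S)%E
  + ((1 - t * t') + (1 - t * t') * thalf D) / 4 * f D
  + ((1 - t * t') - (1 - t * t') * thalf D) / 4 * f (- D)%E); first by field.
by rewrite eS eD; field.
Qed.

Lemma sech_oppD z w : sech (- z + w)%E = sech (z - w)%E.
Proof.
case: z w => [r| |] [s| |] //.
by rewrite -sechN; congr (sech _%:E); ring.
Qed.

Definition chord z w : R := sech z * sech w * ((sech (z + w)%E + sech (z - w)%E) / 2).

Lemma symz_tilt2 z w :
  symz (fun z' => symz (fun w' => tilt z' * tilt w' * sech (z' + w')%E) w) z = chord z w.
Proof.
under [X in symz X]eq_fun => z'.
  rewrite (_ : symz _ w = tilt z' * (sech w * ((sech (z' + w)%E + sech (z' - w)%E) / 2))).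
    over.
  rewrite -(symz_tilt (fun w' => sech (z' + w')%E)) /symz; ring.
rewrite (symz_tilt (fun z' => sech w * ((sech (z' + w)%E + sech (z' - w)%E) / 2))) /chord.
have -> : sech (- z - w)%E = sech (z + w)%E by rewrite sech_oppD oppeK.
by rewrite sech_oppD; field.
Qed.

(** In terms of cosh this reads 1 / chord = cosh^2(z/2) + cosh^2(w/2) - 1, from cosh(A + B) cosh(A -
    B) = cosh^2 A + cosh^2 B - 1 and cosh(A + B) + cosh(A - B) = 2 cosh A cosh B. *)
Lemma chordE z w : let u := sech z ^+ 2 in let v := sech w ^+ 2 in
  chord z w = u * v / (u + v - u * v).
Proof.
rewrite /= /chord; case: z w => [r| |] [s| |];
  rewrite /= ?(mul0r, mulr0, expr0n)//= ?(mul0r, mulr0)//.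
rewrite -!/(sech _%:E) !sechE /=.
have -> : (r + s) / 2 = r / 2 + s / 2 by field.
have -> : (r - s) / 2 = r / 2 - s / 2 by field.
rewrite !expRD expRN.
have := expR_gt0 (r / 2); have := expR_gt0 (s / 2).
set q := expR (r / 2); set p := expR (s / 2) => p0 q0.
set X := q ^+ 2 + 1; set Y := p ^+ 2 + 1.
set M := (q * p) ^+ 2 + 1; pose N := q ^+ 2 + p ^+ 2.
have X0 : X != 0 by rewrite gt_eqF// /X; nra.
have Y0 : Y != 0 by rewrite gt_eqF// /Y; nra.
have M0 : M != 0 by rewrite gt_eqF// /M; nra.
have N0 : N != 0 by rewrite gt_eqF// /N; nra.
have p0' : p != 0 by rewrite gt_eqF.
have q0' : q != 0 by rewrite gt_eqF.
have -> : 2 * (q / p) / ((q / p) ^+ 2 + 1) = 2 * (q * p) / N.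
  have e : (q / p) ^+ 2 + 1 = N / p ^+ 2 by rewrite /N; field.
  by rewrite e; field; rewrite ?N0 ?p0'.
have XYE : X * Y = M + N by rewrite /X /Y /M /N; ring.
have MNE : M * N = q ^+ 2 * Y ^+ 2 + p ^+ 2 * X ^+ 2 - 4 * (q * p) ^+ 2.
  by rewrite /X /Y /M /N; ring.
clearbody X Y M N.
transitivity (4 * (q * p) ^+ 2 / (M * N)).
  have -> : 2 * (q * p) / M + 2 * (q * p) / N = 2 * (q * p) * (X * Y) / (M * N).
    by rewrite XYE; field; rewrite ?M0 ?N0.
  by field; rewrite ?X0 ?Y0 ?M0 ?N0.
have -> : (2 * q / X) ^+ 2 + (2 * p / Y) ^+ 2 - (2 * q / X) ^+ 2 * (2 * p / Y) ^+ 2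
    = 4 * (M * N) / (X * Y) ^+ 2.
  by rewrite MNE; field; rewrite ?X0 ?Y0.
by field; rewrite ?X0 ?Y0 ?M0 ?N0.
Qed.

(** For fixed v in ]0, 1], the map u -> u v / (u + v - u v) is nondecreasing, concave and zero at 0,
    hence subadditive; a check node combines u and u' into u + u' - u u' <= u + u'. *)
Lemma chord_chk z z' w : chord (chk_llr (z, z')) w <= chord z w + chord z' w.
Proof.
rewrite !chordE /= sech_chk.
have bd (x : \bar R) : 0 <= sech x ^+ 2 <= 1.
  by rewrite sqr_ge0 /= expr_le1// ?sech_ge0// sech_le1.
have /andP[u0 u1] := bd z; have /andP[u'0 u'1] := bd z'; have /andP[v0 v1] := bd w.
move: (sech z ^+ 2) (sech z' ^+ 2) (sech w ^+ 2) u0 u1 u'0 u'1 v0 v1.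
move=> u u' v u0 u1 u'0 u'1 v0 v1.
have [->|v_neq0] := eqVneq v 0; first by rewrite !mulr0 !mul0r addr0.
have {v_neq0} {}v0 : 0 < v by rewrite lt_neqAle eq_sym v_neq0.
(* The sum u + u' may exceed 1; the denominator stays positive because it is v + x (1 - v). *)
have d0 x : 0 <= x -> 0 < x + v - x * v by nra.
pose c := u + u' - u * u'.
have c0 : 0 <= c by rewrite /c; nra.
have h1 : c * v / (c + v - c * v) <= (u + u') * v / (u + u' + v - (u + u') * v).
  rewrite ler_pdivrMr; last exact: d0.
  rewrite mulrAC ler_pdivlMr; last by apply: d0; rewrite addr_ge0.
  have : c <= u + u' by rewrite /c; nra.
  by move=> ?; rewrite -subr_ge0 (_ : _ - _ = v ^+ 2 * (u + u' - c)); [nra|ring].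
apply: (le_trans h1); rewrite mulrDl mulrDl.
apply: lerD; rewrite -!mulrA ler_wpM2l// ler_wpM2l ?(ltW v0)// lef_pV2 ?posrE.
- by nra.
- by have := @d0 (u + u'); rewrite -mulrDl; apply; rewrite addr_ge0.
- exact: d0.
- by nra.
- by have := @d0 (u + u'); rewrite -mulrDl; apply; rewrite addr_ge0.
- exact: d0.
Qed.

End symmetrization.

(** * Symmetric densities *)

Section integrals.
Context d (T : measurableType d) {R : realType}.
Implicit Types (mu : {measure set T -> \bar R}) (f g : T -> R).

Lemma ge0_eq_intD mu f g : measurable_fun setT f -> measurable_fun setT g ->
    (forall z, 0 <= f z) -> (forall z, 0 <= g z) ->
  (\int[mu]_z (f z + g z)%:E = \int[mu]_z (f z)%:E + \int[mu]_z (g z)%:E)%E.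
Proof.
move=> mf mg f0 g0; under eq_integral do rewrite EFinD.
by rewrite ge0_integralD//; do ?[exact/measurable_EFinP|move=> x _; rewrite lee_fin].
Qed.

Lemma ge0_eq_intZ mu (k : R) f : measurable_fun setT f ->
    (forall z, 0 <= f z) -> 0 <= k ->
  (\int[mu]_z (k * f z)%:E = k%:E * \int[mu]_z (f z)%:E)%E.
Proof.
move=> mf f0 k0; under eq_integral do rewrite EFinM.
by rewrite ge0_integralZl//; do ?[exact/measurable_EFinP|move=> x _; rewrite lee_fin].
Qed.

Lemma ge0_le_int mu f g : measurable_fun setT f -> measurable_fun setT g ->
    (forall z, 0 <= f z) -> (forall z, f z <= g z) ->
  (\int[mu]_z (f z)%:E <= \int[mu]_z (g z)%:E)%E.
Proof.
move=> mf mg f0 fg; apply: ge0_le_integral => //.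
- by move=> x _; rewrite lee_fin.
- exact/measurable_EFinP.
- exact/measurable_EFinP.
- by move=> x _; rewrite lee_fin.
Qed.

End integrals.

Section symmetric.
Context {R : realType}.
Implicit Types (a b c : probability (\bar R) R) (z w : \bar R) (f g : \bar R -> R).
Implicit Types F G : \bar R * \bar R -> R.

(* Functional form of symmetry: given the pair [{z, -z}], the value [z] has
   probability (1 + tanh (z / 2)) / 2.  Unlike [symmetric_density], it forces
   [a] not to charge -oo. *)
Definition symm a := forall f, measurable_fun setT f -> (forall z, 0 <= f z) ->
  (\int[a]_z (f z)%:E = \int[a]_z (symz f z)%:E)%E.

Lemma measurable_section1 F w : measurable_fun setT F ->
  measurable_fun setT (fun z => F (z, w)).
Proof. by move=> mF; apply: measurableT_comp => //; exact: measurable_fun_pair. Qed.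

Lemma measurable_section2 F z : measurable_fun setT F ->
  measurable_fun setT (fun w => F (z, w)).
Proof. by move=> mF; apply: measurableT_comp => //; exact: measurable_fun_pair. Qed.

Lemma int2C a b F : measurable_fun setT F -> (forall p, 0 <= F p) ->
  (\int[a]_z \int[b]_w (F (z, w))%:E = \int[b]_w \int[a]_z (F (z, w))%:E)%E.
Proof.
move=> mF F0; apply: (fubini_tonelli (fun p => (F p)%:E)) => //.
exact/measurable_EFinP.
Qed.

Lemma measurable_int2 b F : measurable_fun setT F -> (forall p, 0 <= F p) ->
  measurable_fun setT (fun z => \int[b]_w (F (z, w))%:E)%E.
Proof.
move=> mF F0.
apply: (measurable_fun_fubini_tonelli_F (fun p => (F p)%:E)) => //.
exact/measurable_EFinP.
Qed.

Lemma le_int2 a b F G : measurable_fun setT F -> measurable_fun setT G ->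
    (forall p, 0 <= F p) -> (forall p, F p <= G p) ->
  (\int[a]_z \int[b]_w (F (z, w))%:E <= \int[a]_z \int[b]_w (G (z, w))%:E)%E.
Proof.
move=> mF mG F0 FG; have G0 p : 0 <= G p by exact: le_trans (FG p).
apply: ge0_le_integral => //.
- by move=> z _; apply: integral_ge0 => w _; rewrite lee_fin.
- exact: measurable_int2.
- exact: measurable_int2.
- by move=> z _; apply: ge0_le_int => //; exact: measurable_section2.
Qed.

Lemma int2D a b F G : measurable_fun setT F -> measurable_fun setT G ->
    (forall p, 0 <= F p) -> (forall p, 0 <= G p) ->
  (\int[a]_z \int[b]_w (F (z, w) + G (z, w))%:E =
   \int[a]_z \int[b]_w (F (z, w))%:E + \int[a]_z \int[b]_w (G (z, w))%:E)%E.
Proof.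
move=> mF mG F0 G0; rewrite -ge0_integralD//.
- apply: eq_integral => z _; rewrite -ge0_eq_intD//; exact: measurable_section2.
- by move=> z _; apply: integral_ge0 => w _; rewrite lee_fin.
- exact: measurable_int2.
- by move=> z _; apply: integral_ge0 => w _; rewrite lee_fin.
- exact: measurable_int2.
Qed.

Lemma int2M a b f g : measurable_fun setT f -> measurable_fun setT g ->
    (forall z, 0 <= f z) -> (forall z, 0 <= g z) ->
  (\int[a]_z \int[b]_w (f z * g w)%:E = \int[a]_z (f z)%:E * \int[b]_w (g w)%:E)%E.
Proof.
move=> mf mg f0 g0.
under eq_integral do rewrite ge0_eq_intZ//.
rewrite ge0_integralZr//.
- exact/measurable_EFinP.
- by move=> z _; rewrite lee_fin.
- by apply: integral_ge0 => w _; rewrite lee_fin.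
Qed.

Lemma int_cst a (k : \bar R) : (\int[a]_z k = k)%E.
Proof. by rewrite integral_cst//= probability_setT mule1. Qed.

Lemma int_var a b f : measurable_fun setT f -> (forall z, 0 <= f z) ->
  (\int[var_conv a b]_z (f z)%:E = \int[a]_z \int[b]_w (f (z + w))%:E)%E.
Proof.
move=> mf f0; have mf' : measurable_fun setT (fun z => (f z)%:E) by exact/measurable_EFinP.
rewrite ge0_integral_distribution//.
rewrite -[RHS](fubini_tonelli1 (fun p => (f (p.1 + p.2)%E)%:E))//.
apply/measurable_EFinP; apply: measurableT_comp => //.
exact: measurable_var_llr.
by move=> p; rewrite lee_fin.
Qed.

Lemma int_chk a b f : measurable_fun setT f -> (forall z, 0 <= f z) ->
  (\int[chk_conv a b]_z (f z)%:E = \int[a]_z \int[b]_w (f (chk_llr (z, w)))%:E)%E.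
Proof.
move=> mf f0; have mf' : measurable_fun setT (fun z => (f z)%:E) by exact/measurable_EFinP.
rewrite ge0_integral_distribution//.
rewrite -[RHS](fubini_tonelli1 (fun p => (f (chk_llr p))%:E))//.
apply/measurable_EFinP; exact: measurableT_comp.
by move=> p; rewrite lee_fin.
Qed.

Lemma int_dirac z f : measurable_fun setT f ->
  (\int[dirac z]_x (f x)%:E = (f z)%:E)%E.
Proof.
move=> mf; rewrite integral_dirac//; last exact/measurable_EFinP.
by rewrite diracT mul1e.
Qed.

Lemma measurable_symz1 F : measurable_fun setT F ->
  measurable_fun setT (fun p => symz (fun z => F (z, p.2)) p.1).
Proof.
move=> mF; have mt : measurable_fun setT (fun p : \bar R * \bar R => thalf p.1).
  by apply: measurableT_comp => //; exact: measurable_thalf.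
apply: measurable_funD; apply: measurable_funM => //.
- by apply: measurable_funM => //; exact: measurable_funD.
- by rewrite (_ : (fun x => _) = F)//; apply/funext => -[].
- by apply: measurable_funM => //; exact: measurable_funB.
- apply: measurableT_comp => //; apply: measurable_fun_pair => //.
  by apply: measurableT_comp => //; exact: oppe_measurable.
Qed.

Lemma measurable_symz2 F : measurable_fun setT F ->
  measurable_fun setT (fun p => symz (fun w => F (p.1, w)) p.2).
Proof.
move=> mF; have mt : measurable_fun setT (fun p : \bar R * \bar R => thalf p.2).
  by apply: measurableT_comp => //; exact: measurable_thalf.
apply: measurable_funD; apply: measurable_funM => //.
- by apply: measurable_funM => //; exact: measurable_funD.
- by rewrite (_ : (fun x => _) = F)//; apply/funext => -[].
- by apply: measurable_funM => //; exact: measurable_funB.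
- apply: measurableT_comp => //; apply: measurable_fun_pair => //.
  by apply: measurableT_comp => //; exact: oppe_measurable.
Qed.

Lemma symm2 a b F : symm a -> symm b -> measurable_fun setT F ->
    (forall p, 0 <= F p) ->
  (\int[a]_z \int[b]_w (F (z, w))%:E =
   \int[a]_z \int[b]_w (symz (fun z' => symz (fun w' => F (z', w')) w) z)%:E)%E.
Proof.
move=> sa sb mF F0.
pose F2 p := symz (fun w' => F (p.1, w')) p.2.
pose F12 p := symz (fun z' => F2 (z', p.2)) p.1.
have mF2 : measurable_fun setT F2 by exact: measurable_symz2.
have mF12 : measurable_fun setT F12 by exact: measurable_symz1.
have F20 p : 0 <= F2 p by apply: symz_ge0.
have F120 p : 0 <= F12 p by apply: symz_ge0.
transitivity (\int[a]_z \int[b]_w (F2 (z, w))%:E)%E.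
  by apply: eq_integral => z _; rewrite sb//; exact: measurable_section2.
transitivity (\int[a]_z \int[b]_w (F12 (z, w))%:E)%E; last by [].
rewrite (int2C a b mF2 F20) (int2C a b mF12 F120).
by apply: eq_integral => w _; rewrite sa//; exact: measurable_section1.
Qed.

Lemma symm_var a b : symm a -> symm b -> symm (var_conv a b).
Proof.
move=> sa sb f mf f0.
have madd g : measurable_fun setT g ->
    measurable_fun setT (fun p : \bar R * \bar R => g (p.1 + p.2)%E).
  by move=> mg; apply: measurableT_comp => //; exact: measurable_var_llr.
have mfs := measurable_symz mf; have fs0 := symz_ge0 f0.
rewrite (int_var a b mf f0) (int_var a b mfs fs0).
rewrite (symm2 (F := fun p => f (p.1 + p.2)%E) sa sb (madd _ mf) (fun=> f0 _)).
rewrite (symm2 (F := fun p => symz f (p.1 + p.2)%E) sa sb (madd _ mfs) (fun=> fs0 _)).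
apply: eq_integral => z _; apply: eq_integral => w _ /=.
by rewrite symz_var.
Qed.

Lemma symm_chk a b : symm a -> symm b -> symm (chk_conv a b).
Proof.
move=> sa sb f mf f0.
have mfs := measurable_symz mf; have fs0 := symz_ge0 f0.
have mc : measurable_fun setT (fun p : \bar R * \bar R => f (chk_llr p)).
  by apply: measurableT_comp => //; exact: measurable_chk_llr.
rewrite (int_chk a b mf f0) (int_chk a b mfs fs0).
rewrite (symm2 (F := fun p => f (chk_llr p)) sa sb mc (fun=> f0 _)).
apply: eq_integral => z _; apply: eq_integral => w _ /=.
by rewrite symz_chk.
Qed.

Lemma symm_dirac0 : symm (dirac 0%E).
Proof.
move=> f mf f0; rewrite !int_dirac//; last exact: measurable_symz.
by rewrite /symz oppe0; congr (_%:E); field.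
Qed.

Lemma symm_diracy : symm (dirac +oo%E).
Proof.
move=> f mf f0; rewrite !int_dirac//; last exact: measurable_symz.
by rewrite /symz thalfy; congr (_%:E); field.
Qed.

Lemma symm_var_pow a n : symm a -> symm (var_pow a n).
Proof.
by move=> sa; elim: n => [|n ih]; [exact: symm_dirac0|exact: symm_var].
Qed.

Lemma symm_chk_pow a n : symm a -> symm (chk_pow a n).
Proof.
by move=> sa; elim: n => [|n ih]; [exact: symm_diracy|exact: symm_chk].
Qed.

Lemma int_mixture (I : Type) (s : seq I) (w : I -> R) (P : I -> probability (\bar R) R)
    (w_ge0 : forall i, 0 <= w i) (w_sum1 : \sum_(i <- s) w i = 1) f :
    measurable_fun setT f -> (forall z, 0 <= f z) ->
  (\int[mixture P w_ge0 w_sum1]_z (f z)%:E = \sum_(i <- s) (w i)%:E * \int[P i]_z (f z)%:E)%E.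
Proof.
move=> mf f0; rewrite ge0_integral_mixture//.
exact/measurable_EFinP.
Qed.

Lemma symm_mixture (I : Type) (s : seq I) (w : I -> R) (P : I -> probability (\bar R) R)
    (w_ge0 : forall i, 0 <= w i) (w_sum1 : \sum_(i <- s) w i = 1) :
  (forall i, symm (P i)) -> symm (mixture P w_ge0 w_sum1).
Proof.
move=> sP f mf f0; rewrite !int_mixture//; last 2 first.
- exact: measurable_symz.
- exact: symz_ge0.
by apply: eq_bigr => i _; rewrite sP.
Qed.

Lemma symm_tilt a f : symm a -> measurable_fun setT f -> (forall z, 0 <= f z) ->
  (\int[a]_z (tilt z * f z)%:E =
   \int[a]_z (sech z * ((f z + f (- z)%E) / 2))%:E)%E.
Proof.
move=> sa mf f0; rewrite sa.
- by apply: eq_integral => z _; rewrite symz_tilt.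
- by apply: measurable_funM => //; exact: measurable_tilt.
- by move=> z; rewrite mulr_ge0// tilt_ge0.
Qed.

End symmetric.

(** * Bhattacharyya constant and mean-square error *)

Section functionals.
Context {R : realType}.
Implicit Types (a b c : probability (\bar R) R) (z w : \bar R) (f g : \bar R -> R).

Lemma int_finite a f (k : R) : measurable_fun setT f -> (forall z, 0 <= f z <= k) ->
  exists2 r : R, 0 <= r <= k & (\int[a]_z (f z)%:E = r%:E)%E.
Proof.
move=> mf fk.
have f0 z : 0 <= f z by have /andP[] := fk z.
have f1 z : f z <= k by have /andP[] := fk z.
have h0 : (0 <= \int[a]_z (f z)%:E)%E.
  by apply: integral_ge0 => z _; rewrite lee_fin.
have h1 : (\int[a]_z (f z)%:E <= k%:E)%E.
  by rewrite -(int_cst a k%:E); apply: ge0_le_int.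
have hf : (\int[a]_z (f z)%:E)%E \is a fin_num.
  by rewrite ge0_fin_numE// (le_lt_trans h1)// ltry.
exists (fine (\int[a]_z (f z)%:E)%E); last by rewrite fineK.
by rewrite fine_ge0//= -lee_fin fineK.
Qed.

(** For symmetric [a] this is the mass of the tilted law ([int_tilt]). The bounded kernel [sech]
    makes it a real number for every [a]. *)
Definition batta a : R := fine (\int[a]_z (sech z)%:E)%E.

(** The integral of 1 - tanh^2(z/2): the minimum mean-square error in estimating a sign bit from its
    LLR. *)
Definition mmse a : R := fine (\int[a]_z (sech z ^+ 2)%:E)%E.

Lemma sech_bound z : 0 <= sech z <= 1.
Proof. by rewrite sech_ge0 sech_le1. Qed.

Lemma sech2_bound z : 0 <= sech z ^+ 2 <= 1.
Proof. by rewrite sqr_ge0 expr_le1// ?sech_ge0// sech_le1. Qed.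

Lemma measurable_sech2 : measurable_fun setT (fun z : \bar R => sech z ^+ 2).
Proof. by apply: measurable_funX; exact: measurable_sech. Qed.

Lemma battaE a : (\int[a]_z (sech z)%:E = (batta a)%:E)%E.
Proof.
by rewrite /batta; have [r _ ->] := int_finite a measurable_sech sech_bound.
Qed.

Lemma batta_bound a : 0 <= batta a <= 1.
Proof.
by rewrite /batta; have [r r01 ->] := int_finite a measurable_sech sech_bound.
Qed.

Lemma batta_ge0 a : 0 <= batta a. Proof. by have /andP[] := batta_bound a. Qed.

Lemma mmseE a : (\int[a]_z (sech z ^+ 2)%:E = (mmse a)%:E)%E.
Proof.
by rewrite /mmse; have [r _ ->] := int_finite a measurable_sech2 sech2_bound.
Qed.

Lemma int_tilt a : symm a -> (\int[a]_z (tilt z)%:E = (batta a)%:E)%E.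
Proof.
move=> sa; rewrite -battaE; under eq_integral do rewrite -[tilt _]mulr1.
rewrite (@symm_tilt _ a (fun=> 1))//.
by apply: eq_integral => z _; congr (_%:E); field.
Qed.

Lemma int_tilt_sech a : symm a -> (\int[a]_z (tilt z * sech z)%:E = (mmse a)%:E)%E.
Proof.
move=> sa; rewrite -mmseE symm_tilt//.
- by apply: eq_integral => z _; congr (_%:E); rewrite sechN; field.
- exact: measurable_sech.
- exact: sech_ge0.
Qed.

Lemma batta_var a b : symm a -> symm b ->
  batta (var_conv a b) = batta a * batta b.
Proof.
move=> sa sb; apply: EFin_inj; rewrite -int_tilt; last exact: symm_var.
rewrite int_var; [|exact: measurable_tilt|exact: tilt_ge0].
under eq_integral => z _ do under eq_integral => w _ do rewrite tiltD.
rewrite int2M; [|exact: measurable_tilt|exact: measurable_tilt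
  |exact: tilt_ge0|exact: tilt_ge0].
by rewrite !int_tilt.
Qed.

Lemma batta_dirac0 : batta (dirac 0%E) = 1.
Proof.
rewrite /batta int_dirac /=; last exact: measurable_sech.
by rewrite mul0r oppr0 expR0; field.
Qed.

Lemma batta_diracy : batta (dirac +oo%E) = 0.
Proof. by rewrite /batta int_dirac //; exact: measurable_sech. Qed.

Lemma batta_var_pow a n : symm a -> batta (var_pow a n) = batta a ^+ n.
Proof.
move=> sa; elim: n => [|n ih]; first by rewrite expr0 batta_dirac0.
by rewrite exprS -ih -batta_var//; exact: symm_var_pow.
Qed.

Lemma batta_mixture (I : Type) (s : seq I) (w : I -> R)
    (P : I -> probability (\bar R) R)
    (w_ge0 : forall i, 0 <= w i) (w_sum1 : \sum_(i <- s) w i = 1) :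
  batta (mixture P w_ge0 w_sum1) = \sum_(i <- s) w i * batta (P i).
Proof.
apply: EFin_inj; rewrite -battaE int_mixture.
- by rewrite -sumEFin; apply: eq_bigr => i _; rewrite battaE.
- exact: measurable_sech.
- exact: sech_ge0.
Qed.

(** Half the harmonic mean of the two values of [sech]; it is 0 when both vanish. *)
Definition harm z w : R := sech z * sech w / (sech z + sech w).

Lemma harm_ge0 z w : 0 <= harm z w.
Proof. by rewrite divr_ge0// ?mulr_ge0 ?addr_ge0// sech_ge0. Qed.

(* (s + p - sp/(s + p))^2 >= s^2 + p^2 bounds the check-node combination
   sqrt(s^2 + p^2 - s^2 p^2). *)
Lemma sech_chk_harm z w : sech (chk_llr (z, w)) + harm z w <= sech z + sech w.
Proof.
have := sech_chk z w; have /andP[c0 _] := sech_bound (chk_llr (z, w)).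
rewrite /harm; have /andP[s0 s1] := sech_bound z; have /andP[p0 p1] := sech_bound w.
move: (sech (chk_llr _)) (sech z) (sech w) c0 s0 s1 p0 p1 => c s p c0 s0 s1 p0 p1 cE.
have [sp0|sp0] := eqVneq (s + p) 0.
  have [-> ->] : s = 0 /\ p = 0 by split; lra.
  by rewrite !mul0r !addr0; nra.
have {}sp0 : 0 < s + p by rewrite lt_neqAle eq_sym sp0 addr_ge0.
set h := s * p / (s + p).
have hE : h * (s + p) = s * p by rewrite /h divfK// gt_eqF.
have h0 : 0 <= h by rewrite divr_ge0 ?mulr_ge0// ltW.
have hle : h <= s + p by rewrite /h ler_pdivrMr//; nra.
rewrite -lerBrDr -(@ler_pXn2r _ 2)// ?nnegrE ?subr_ge0//.
rewrite cE; have -> : (s + p - h) ^+ 2 = s ^+ 2 + p ^+ 2 + h ^+ 2.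
  by rewrite (_ : (s + p - h) ^+ 2 = (s + p) ^+ 2 - 2 * (h * (s + p)) + h ^+ 2);
    [rewrite hE; ring|ring].
by have := sqr_ge0 (s * p); have := sqr_ge0 h; rewrite exprMn; lra.
Qed.

Lemma sech_chk_ge z w : sech z <= sech (chk_llr (z, w)).
Proof.
rewrite -(@ler_pXn2r _ 2)// ?nnegrE ?sech_ge0// sech_chk.
by have /andP[] := sech2_bound z; have /andP[] := sech2_bound w; nra.
Qed.

(** [harm] increases with each value of [sech], and [sech] only grows at a check node. The gain
    obtained from two inputs thus survives the addition of further inputs. *)
Lemma harm_chk z w x : harm z w <= harm z (chk_llr (w, x)).
Proof.
have := sech_chk_ge w x; rewrite /harm.
have := sech_ge0 z; have := sech_ge0 w; have := sech_ge0 (chk_llr (w, x)).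
move: (sech (chk_llr _)) (sech z) (sech w) => p' s p p'0 p0 s0 pp'.
have [->|sn] := eqVneq s 0; first by rewrite !mul0r.
have {}s0 : 0 < s by rewrite lt_neqAle eq_sym sn.
rewrite ler_pdivrMr ?ltr_pwDl// mulrAC ler_pdivlMr ?ltr_pwDl//.
by have : 0 <= s * s * (p' - p) by [rewrite mulr_ge0 ?subr_ge0// mulr_ge0// ltW]; nra.
Qed.

(** Arithmetic-geometric mean inequality for s p / (s + p) and tau^2 s p (s + p). The parameter
    trades the quotient for products of functions of one variable, whose double integrals factor. *)
Lemma harm_AMGM z w (tau : R) : 0 < tau ->
  2 * tau * (sech z * sech w) <= harm z w +
    tau ^+ 2 * (sech z ^+ 2 * sech w + sech z * sech w ^+ 2).
Proof.
move=> tau0; rewrite /harm; have := sech_ge0 z; have := sech_ge0 w.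
move: (sech z) (sech w) => s p p0 s0.
have [sp0|sp0] := eqVneq (s + p) 0.
  have [-> ->] : s = 0 /\ p = 0 by split; lra.
  by rewrite !(mul0r, mulr0, addr0, expr0n)/= ?(mul0r, mulr0, addr0).
have {}sp0 : 0 < s + p by rewrite lt_neqAle eq_sym sp0 addr_ge0.
rewrite -subr_ge0 (_ : _ - _ = s * p * (1 - tau * (s + p)) ^+ 2 / (s + p)).
  by rewrite divr_ge0 ?(ltW sp0)// mulr_ge0 ?sqr_ge0// mulr_ge0.
by field; rewrite gt_eqF.
Qed.

Lemma measurable_comp_fst f : measurable_fun setT f ->
  measurable_fun setT (fun p : \bar R * \bar R => f p.1).
Proof. by move=> mf; exact: measurableT_comp. Qed.

Lemma measurable_comp_snd f : measurable_fun setT f ->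
  measurable_fun setT (fun p : \bar R * \bar R => f p.2).
Proof. by move=> mf; exact: measurableT_comp. Qed.

Lemma measurable_harm : measurable_fun setT (fun p : \bar R * \bar R => harm p.1 p.2).
Proof.
have m1 := measurable_comp_fst (@measurable_sech R).
have m2 := measurable_comp_snd (@measurable_sech R).
apply: measurable_funM; first exact: measurable_funM.
apply: (measurableT_comp (f := @GRing.inv R)); first exact: measurable_invr.
exact: measurable_funD.
Qed.

Lemma int2_fst a b f : (forall z, 0 <= f z) ->
  (\int[a]_z \int[b]_w (f z)%:E = \int[a]_z (f z)%:E)%E.
Proof. by move=> f0; under eq_integral do rewrite int_cst. Qed.

Lemma int2_snd a b f (r : R) : (\int[b]_w (f w)%:E = r%:E)%E ->
  (\int[a]_z \int[b]_w (f w)%:E = r%:E)%E.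
Proof. by move=> ->; rewrite int_cst. Qed.

Lemma batta_chk_harm a b :
  ((batta (chk_conv a b))%:E + \int[a]_z \int[b]_w (harm z w)%:E <=
   (batta a + batta b)%:E)%E.
Proof.
have ms := @measurable_sech R; have s0 := @sech_ge0 R.
have mh := measurable_harm.
have m1 := measurable_comp_fst ms; have m2 := measurable_comp_snd ms.
have mc : measurable_fun setT (fun p : \bar R * \bar R => sech (chk_llr p)).
  by apply: measurableT_comp => //; exact: measurable_chk_llr.
rewrite -battaE int_chk//.
rewrite -(@int2D _ a b (fun p => sech (chk_llr p)) (fun p => harm p.1 p.2))//; last first.
  by move=> p; exact: harm_ge0.
have -> : ((batta a + batta b)%:E = \int[a]_z \int[b]_w (sech z + sech w)%:E)%E.
  rewrite (@int2D _ a b (fun p => sech p.1) (fun p => sech p.2))//.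
  by rewrite int2_fst// battaE (int2_snd a (battaE b)) EFinD.
apply: (@le_int2 _ a b (fun p => sech (chk_llr p) + harm p.1 p.2)
  (fun p => sech p.1 + sech p.2)).
- exact: measurable_funD.
- exact: measurable_funD.
- by move=> p; rewrite addr_ge0// harm_ge0.
- by move=> [z w]; exact: sech_chk_harm.
Qed.

Lemma batta_chk a b : batta (chk_conv a b) <= batta a + batta b.
Proof.
rewrite -lee_fin; apply: le_trans (batta_chk_harm a b).
rewrite leeDl//; apply: integral_ge0 => z _; apply: integral_ge0 => w _.
by rewrite lee_fin harm_ge0.
Qed.

Lemma batta_chk_pow a n : batta (chk_pow a n) <= n%:R * batta a.
Proof.
elim: n => [|n ih]; first by rewrite mul0r batta_diracy.
by apply: (le_trans (batta_chk _ _)); rewrite -natr1 mulrDl mul1r addrC lerD2r.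
Qed.

(** With x and v for [batta a] and [mmse a], the best choice tau = x / (2 v) would give x^3 / (2 v).
    Leaving tau free avoids the division, and an upper bound on v / x is enough to choose it. *)
Lemma harm_lower a (tau : R) : 0 < tau ->
  ((2 * tau * batta a ^+ 2)%:E <= \int[a]_z \int[a]_w (harm z w)%:E
     + (2 * tau ^+ 2 * batta a * mmse a)%:E)%E.
Proof.
move=> tau0.
have ms := @measurable_sech R; have s0 := @sech_ge0 R.
have ms2 := measurable_sech2.
have mh := measurable_harm.
have m1 := measurable_comp_fst ms; have m2 := measurable_comp_snd ms.
have m12 := measurable_comp_fst ms2; have m22 := measurable_comp_snd ms2.
have -> : ((2 * tau * batta a ^+ 2)%:E = \int[a]_z \int[a]_w (2 * tau * sech z * sech w)%:E)%E.
  rewrite (@int2M _ a a (fun z => 2 * tau * sech z) sech)//; last 2 first.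
  - exact: measurable_funM.
  - by move=> z; rewrite mulr_ge0// mulr_ge0// ltW.
  rewrite ge0_eq_intZ// ?mulr_ge0// ?ltW// !battaE -!EFinM.
  by congr (_%:E); ring.
have -> : ((2 * tau ^+ 2 * batta a * mmse a)%:E =
    \int[a]_z \int[a]_w (tau ^+ 2 * sech z ^+ 2 * sech w + tau ^+ 2 * sech z * sech w ^+ 2)%:E)%E.
  rewrite (@int2D _ a a (fun p => tau ^+ 2 * sech p.1 ^+ 2 * sech p.2)
    (fun p => tau ^+ 2 * sech p.1 * sech p.2 ^+ 2)); last 4 first.
  - by apply: measurable_funM => //; exact: measurable_funM.
  - by apply: measurable_funM => //; exact: measurable_funM.
  - by move=> p; rewrite mulr_ge0// mulr_ge0// sqr_ge0.
  - by move=> p; rewrite mulr_ge0// ?sqr_ge0// mulr_ge0// sqr_ge0.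
  rewrite (@int2M _ a a (fun z => tau ^+ 2 * sech z ^+ 2) sech)//; last 2 first.
  - exact: measurable_funM.
  - by move=> z; rewrite mulr_ge0// sqr_ge0.
  rewrite (@int2M _ a a (fun z => tau ^+ 2 * sech z) (fun w => sech w ^+ 2))//; last 3 first.
  - exact: measurable_funM.
  - by move=> z; rewrite mulr_ge0// sqr_ge0.
  - by move=> z; rewrite sqr_ge0.
  rewrite !ge0_eq_intZ// ?sqr_ge0//; last by move=> z; rewrite sqr_ge0.
  rewrite battaE mmseE -!EFinM -EFinD.
  by congr (_%:E); ring.
rewrite -(@int2D _ a a (fun p => harm p.1 p.2)
  (fun p => tau ^+ 2 * sech p.1 ^+ 2 * sech p.2 +
   tau ^+ 2 * sech p.1 * sech p.2 ^+ 2))//; last 3 first.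
- by apply: measurable_funD; apply: measurable_funM => //; exact: measurable_funM.
- by move=> p; exact: harm_ge0.
- by move=> p; rewrite addr_ge0// mulr_ge0// ?sqr_ge0// mulr_ge0// ?sqr_ge0.
apply: (@le_int2 _ a a (fun p => 2 * tau * sech p.1 * sech p.2)
  (fun p => harm p.1 p.2 + (tau ^+ 2 * sech p.1 ^+ 2 * sech p.2 +
    tau ^+ 2 * sech p.1 * sech p.2 ^+ 2))).
- by apply: measurable_funM => //; exact: measurable_funM.
- apply: measurable_funD => //.
  by apply: measurable_funD; apply: measurable_funM => //; exact: measurable_funM.
- by move=> p; rewrite mulr_ge0// mulr_ge0// mulr_ge0// ltW.
- move=> [z w] /=; have := harm_AMGM z w tau0.
  by rewrite mulrDr !mulrA.
Qed.

Lemma batta_chk_gain a n (tau : R) : 0 < tau -> (1 < n)%N ->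
  batta (chk_pow a n) + 2 * tau * batta a ^+ 2 <=
  n%:R * batta a + 2 * tau ^+ 2 * batta a * mmse a.
Proof.
move=> tau0; case: n => [|[|n]]// _.
set c := chk_pow a n; rewrite [chk_pow a _]/= -/(chk_conv a (chk_conv a c)).
have mh := measurable_harm.
(* Only the first two of the n + 2 inputs are exploited for the gain; [c] gathers the others. *)
have hle : (\int[a]_z \int[a]_w (harm z w)%:E <=
            \int[a]_z \int[chk_conv a c]_w (harm z w)%:E)%E.
  apply: ge0_le_integral => //.
  - by move=> z _; apply: integral_ge0 => w _; rewrite lee_fin harm_ge0.
  - by apply: (@measurable_int2 _ a (fun p => harm p.1 p.2)) => // p; exact: harm_ge0.
  - by apply: (@measurable_int2 _ _ (fun p => harm p.1 p.2)) => // p; exact: harm_ge0.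
  move=> z _; rewrite int_chk; last 2 first.
  - exact: (measurable_section2 z mh).
  - by move=> w; exact: harm_ge0.
  rewrite -(@int2_fst a c); last by move=> w; exact: harm_ge0.
  apply: (@le_int2 _ a c (fun p => harm z p.1) (fun p => harm z (chk_llr p))).
  - exact: measurable_comp_fst (measurable_section2 z mh).
  - apply: (measurableT_comp (f := harm z)); first exact: (measurable_section2 z mh).
    exact: measurable_chk_llr.
  - by move=> p; exact: harm_ge0.
  - by move=> [w x]; exact: harm_chk.
rewrite -lee_fin EFinD; have h1 := harm_lower a tau0.
apply: (le_trans (leeD2l _ h1)); rewrite addeA [leRHS]EFinD leeD2r//.
apply: (le_trans (leeD2l _ hle)); apply: (le_trans (batta_chk_harm _ _)).
rewrite lee_fin; have := batta_chk_pow a n; have := batta_chk a c.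
by rewrite -!natr1 !mulrDl !mul1r /c; lra.
Qed.

End functionals.

(** * Equality in law, and the mean-square error after a convolution *)

Section laws.
Context {R : realType}.
Implicit Types (a b c : probability (\bar R) R) (z w : \bar R) (f g : \bar R -> R).

(** Convolutions associated in different orders are distinct terms with the same integrals; equality
    of integrals is all that [mmse] sees. *)
Definition eqlaw a b := forall f, measurable_fun setT f -> (forall z, 0 <= f z) ->
  (\int[a]_z (f z)%:E = \int[b]_z (f z)%:E)%E.

Lemma measurable_add f : measurable_fun setT f ->
  measurable_fun setT (fun p : \bar R * \bar R => f (p.1 + p.2)%E).
Proof. by move=> mf; apply: measurableT_comp => //; exact: measurable_var_llr. Qed.

Lemma measurable_shift f z : measurable_fun setT f ->
  measurable_fun setT (fun w => f (z + w)%E).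
Proof. by move=> /measurable_add mf; exact: (measurable_section2 z mf). Qed.

Lemma eqlaw_mmse a b : eqlaw a b -> mmse a = mmse b.
Proof.
move=> ab; rewrite /mmse ab//; first exact: measurable_sech2.
by move=> z; exact: sqr_ge0.
Qed.

Lemma eqlaw_var2 a b b' : eqlaw b b' -> eqlaw (var_conv a b) (var_conv a b').
Proof.
move=> bb f mf f0; rewrite !int_var//; apply: eq_integral => z _.
by rewrite bb//; exact: measurable_shift.
Qed.

Lemma eqlaw_varC a b : eqlaw (var_conv a b) (var_conv b a).
Proof.
move=> f mf f0; rewrite !int_var//.
rewrite (@int2C _ a b (fun p => f (p.1 + p.2)%E)); [|exact: measurable_add|by []].
by under eq_integral => z _ do under eq_integral => w _ do rewrite addeC.
Qed.

Lemma eqlaw_trans a b c : eqlaw a b -> eqlaw b c -> eqlaw a c.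
Proof. by move=> ab bc f mf f0; rewrite ab// bc. Qed.

Lemma eqlaw_var1 a a' b : eqlaw a a' -> eqlaw (var_conv a b) (var_conv a' b).
Proof.
move=> aa; apply: (eqlaw_trans (eqlaw_varC _ _)).
by apply: (eqlaw_trans (eqlaw_var2 _ aa)); exact: eqlaw_varC.
Qed.

Lemma eqlaw_varA a b c :
  eqlaw (var_conv (var_conv a b) c) (var_conv a (var_conv b c)).
Proof.
move=> f mf f0; rewrite (int_var (var_conv a b) c mf f0) (int_var a _ mf f0).
rewrite (@int2C _ (var_conv a b) c (fun p => f (p.1 + p.2)%E))//; last exact: measurable_add.
under eq_integral => w _.
  rewrite int_var//; last first.
    by under eq_fun do rewrite addeC; exact: measurable_shift.
  over.
transitivity (\int[a]_z \int[c]_w \int[b]_x (f (z + x + w))%:E)%E.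
  rewrite (fubini_tonelli (fun p : \bar R * \bar R => \int[b]_x (f (p.2 + x + p.1))%:E)%E)//.
  - apply: (measurable_fun_fubini_tonelli_F (fun q : (\bar R * \bar R) * \bar R => (f (q.1.2 + q.2 + q.1.1)%E)%:E)).
      apply/measurable_EFinP; apply: measurableT_comp => //.
      apply: emeasurable_funD => //; last by apply: measurableT_comp => //.
      by apply: emeasurable_funD => //; exact: measurableT_comp.
    by move=> q; rewrite lee_fin.
  - by move=> p; apply: integral_ge0 => x _; rewrite lee_fin.
apply: eq_integral => z _.
rewrite int_var//; last exact: measurable_shift.
rewrite (@int2C _ c b (fun p => f (z + p.2 + p.1)%E)); [|apply: measurableT_comp mf _;
  by apply: emeasurable_funD => //; exact: emeasurable_funD|by []].
by apply: eq_integral => x _; apply: eq_integral => w _; rewrite addeA.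
Qed.

Lemma eqlaw_var0 a : eqlaw (var_conv a (dirac 0%E)) a.
Proof.
move=> f mf f0; rewrite int_var//; apply: eq_integral => z _.
by rewrite int_dirac ?adde0//; exact: measurable_shift.
Qed.

Lemma eqlaw_var_pow a j m :
  eqlaw (var_conv (var_pow a j) (var_pow a m)) (var_pow a (j + m)).
Proof.
elim: j => [|j ih].
  by apply: (eqlaw_trans (eqlaw_varC _ _)); exact: eqlaw_var0.
rewrite addSn; apply: (eqlaw_trans (eqlaw_varA _ _ _)).
exact: eqlaw_var2.
Qed.

Lemma measurable_chord :
  measurable_fun setT (fun p : \bar R * \bar R => chord p.1 p.2).
Proof.
have ms := @measurable_sech R.
have m1 := measurable_comp_fst ms; have m2 := measurable_comp_snd ms.
apply: measurable_funM; first exact: measurable_funM.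
apply: measurable_funM => //; apply: measurable_funD; first exact: measurable_add.
by apply: measurableT_comp => //; exact: emeasurable_funB.
Qed.

Lemma chord_ge0 z w : 0 <= chord z w.
Proof.
by rewrite /chord mulr_ge0// ?mulr_ge0 ?divr_ge0 ?addr_ge0// sech_ge0.
Qed.

Lemma mmse_tilt a c : symm a -> symm c ->
  ((mmse (var_conv a c))%:E =
   \int[a]_z \int[c]_w (tilt z * tilt w * sech (z + w)%E)%:E)%E.
Proof.
move=> sa sc; rewrite -int_tilt_sech; last exact: symm_var.
rewrite int_var; [|by apply: measurable_funM; [exact: measurable_tilt|exact: measurable_sech]
  |by move=> z; rewrite mulr_ge0 ?tilt_ge0 ?sech_ge0].
by apply: eq_integral => z _; apply: eq_integral => w _; rewrite tiltD.
Qed.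

Lemma mmse_chord a c : symm a -> symm c ->
  ((mmse (var_conv a c))%:E = \int[a]_z \int[c]_w (chord z w)%:E)%E.
Proof.
move=> sa sc; rewrite (mmse_tilt sa sc).
rewrite (symm2 (F := fun p => tilt p.1 * tilt p.2 * sech (p.1 + p.2)%E) sa sc).
- by apply: eq_integral => z _; apply: eq_integral => w _; rewrite symz_tilt2.
- apply: measurable_funM; last exact: measurable_add (@measurable_sech R).
  apply: measurable_funM; first exact: measurable_comp_fst (@measurable_tilt R).
  exact: measurable_comp_snd (@measurable_tilt R).
- by move=> p; rewrite mulr_ge0 ?sech_ge0// mulr_ge0// tilt_ge0.
Qed.

(** With the integral over [c] taken outermost, the inequality holds for each fixed [w] by
    [chord_chk]. *)
Lemma mmse_chk a b c : symm a -> symm b -> symm c ->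
  mmse (var_conv (chk_conv a b) c) <= mmse (var_conv a c) + mmse (var_conv b c).
Proof.
move=> sa sb sc; rewrite -lee_fin EFinD !mmse_chord//; last exact: symm_chk.
have mk := measurable_chord; have k0 := chord_ge0.
rewrite [leLHS](@int2C _ _ _ (fun p => chord p.1 p.2))//.
rewrite [X in (_ <= X + _)%E](@int2C _ _ _ (fun p => chord p.1 p.2))//.
rewrite [X in (_ <= _ + X)%E](@int2C _ _ _ (fun p => chord p.1 p.2))//.
have mC : measurable_fun setT (fun p : \bar R * \bar R => chord p.2 p.1).
  have := measurableT_comp mk (@measurable_swap _ _ (\bar R) (\bar R)).
  by apply: eq_measurable_fun => p _.
have mi (d : probability (\bar R) R) : measurable_fun setT (fun w => \int[d]_z (chord z w)%:E)%E.
  by apply: (@measurable_int2 _ d (fun p => chord p.2 p.1)).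
have i0 (d : probability (\bar R) R) w : (0 <= \int[d]_z (chord z w)%:E)%E.
  by apply: integral_ge0 => z _; rewrite lee_fin.
rewrite -ge0_integralD//; do ?[by move=> x _; exact: i0].
apply: ge0_le_integral => //; first by move=> w _; exact: i0.
  by apply: emeasurable_funD; exact: mi.
move=> w _.
have mw : measurable_fun setT (fun z => chord z w) by exact: (measurable_section1 w mk).
rewrite int_chk//.
have -> : (\int[a]_z (chord z w)%:E + \int[b]_z (chord z w)%:E =
    \int[a]_z \int[b]_x (chord z w + chord x w)%:E)%E.
  rewrite (@int2D _ a b (fun p => chord p.1 w) (fun p => chord p.2 w)
    (measurable_comp_fst mw) (measurable_comp_snd mw) (fun=> k0 _ _) (fun=> k0 _ _)).
  rewrite (@int2_fst _ a b (fun z => chord z w)); last by move=> z.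
  by congr (_ + _)%E; rewrite /= int_cst.
apply: (@le_int2 _ a b (fun p => chord (chk_llr p) w) (fun p => chord p.1 w + chord p.2 w)).
- by apply: (measurableT_comp mw); exact: measurable_chk_llr.
- by apply: measurable_funD; [exact: (measurable_comp_fst mw)|exact: (measurable_comp_snd mw)].
- by move=> p; exact: k0.
- by move=> [z x]; exact: chord_chk.
Qed.

Lemma mmse_chk_pow a c n : symm a -> symm c ->
  mmse (var_conv (chk_pow a n) c) <= n%:R * mmse (var_conv a c).
Proof.
move=> sa sc; elim: n => [|n ih].
  rewrite mul0r -lee_fin mmse_chord//; last exact: symm_diracy.
  rewrite (@int2C _ _ _ (fun p => chord p.1 p.2))//; last 2 first.
  - exact: measurable_chord.
  - by move=> p; exact: chord_ge0.
  rewrite integral0_eq// => w _; rewrite int_dirac; last first.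
    exact: (measurable_section1 w measurable_chord).
  by rewrite /chord /= !mul0r.
apply: (le_trans (mmse_chk sa (symm_chk_pow n sa) sc)).
by rewrite -natr1 mulrDl mul1r addrC lerD2r.
Qed.

Lemma mmse_le_batta a : mmse a <= batta a.
Proof.
rewrite -lee_fin -mmseE -battaE; apply: ge0_le_int.
- exact: measurable_sech2.
- exact: measurable_sech.
- by move=> z; exact: sqr_ge0.
- by move=> z; rewrite expr2 ler_piMl ?sech_ge0 ?sech_le1.
Qed.

Lemma mmse_mixture (I : Type) (s : seq I) (w : I -> R)
    (P : I -> probability (\bar R) R)
    (w_ge0 : forall i, 0 <= w i) (w_sum1 : \sum_(i <- s) w i = 1) c :
  mmse (var_conv (mixture P w_ge0 w_sum1) c) = \sum_(i <- s) w i * mmse (var_conv (P i) c).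
Proof.
apply: EFin_inj; rewrite -mmseE int_var; [|exact: measurable_sech2|by move=> z; exact: sqr_ge0].
have m2 : measurable_fun setT (fun z => \int[c]_w (sech (z + w)%E ^+ 2)%:E)%E.
  apply: (@measurable_int2 _ c (fun p => sech (p.1 + p.2)%E ^+ 2)).
  - exact: measurable_add measurable_sech2.
  - by move=> p; exact: sqr_ge0.
rewrite ge0_integral_mixture//; last first.
  by move=> z; apply: integral_ge0 => x _; rewrite lee_fin sqr_ge0.
rewrite -sumEFin; apply: eq_bigr => i _.
by rewrite EFinM -mmseE int_var//; [exact: measurable_sech2|move=> z; exact: sqr_ge0].
Qed.

(* [mmse (var_conv a c)] is the integral of [profile c] against the tilted law
   of [a], so it is small compared to [batta a] when the tilted law of [c] is
   spread out. *)
Definition profile c z : \bar R := (\int[c]_w (tilt w * sech (z + w)%E)%:E)%E.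

Lemma mmse_profile a c (D : R) : symm a -> symm c ->
  (forall r : R, (profile c r%:E <= D%:E)%E) ->
  mmse (var_conv a c) <= D * batta a.
Proof.
move=> sa sc cD; rewrite -lee_fin EFinM mmse_tilt// -int_tilt//.
have D0 : 0 <= D.
  rewrite -lee_fin; apply: le_trans (cD 0); apply: integral_ge0 => w _.
  by rewrite lee_fin mulr_ge0 ?tilt_ge0 ?sech_ge0.
have mt := @measurable_tilt R; have ms := @measurable_sech R.
rewrite -ge0_eq_intZ//; last exact: tilt_ge0.
apply: ge0_le_integral => //.
- move=> z _; apply: integral_ge0 => w _.
  by rewrite lee_fin !mulr_ge0 ?tilt_ge0 ?sech_ge0.
- apply: (@measurable_int2 _ c (fun p => tilt p.1 * tilt p.2 * sech (p.1 + p.2)%E)).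
    apply: measurable_funM; last exact: measurable_add.
    by apply: measurable_funM; [exact: measurable_comp_fst|exact: measurable_comp_snd].
  by move=> p; rewrite !mulr_ge0 ?tilt_ge0 ?sech_ge0.
- by apply/measurable_EFinP; exact: measurable_funM.
move=> z _.
under eq_integral do rewrite -mulrA.
rewrite ge0_eq_intZ ?tilt_ge0//; last 2 first.
- by apply: measurable_funM => //; exact: measurable_shift.
- by move=> w; rewrite mulr_ge0 ?tilt_ge0 ?sech_ge0.
(* At infinite z the factor [tilt z] vanishes, so the profile needs a bound at finite points
   only. *)
case: z => [r| |]; rewrite ?mul0e ?mulr0 ?lexx//.
by rewrite mulrC EFinM lee_wpmul2l ?lee_fin ?expR_ge0//; exact: cD.
Qed.

End laws.

(** * One iteration of density evolution *)

Section core_step.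
Context {R : realType} (E : @core_ensemble R).
Implicit Types (a b c : probability (\bar R) R).

Definition chk_slope : R := ((rho1 E)^`()).[1].

(** The fraction of core edges at check nodes with at least two incoming messages, the only ones
    that gain over subadditivity. *)
Definition rho3 : R := \sum_(3 <= k < (kmax E).+1) rho E k.

Definition lambda2 (y : R) : R := \sum_(1 <= j < (jmax E).+1) lambda E 2 j * y ^+ j.

Lemma chk_slopeE : chk_slope = \sum_(k <- chk_degrees E) rho E k * (k.-1)%:R.
Proof.
rewrite /chk_slope /rho1 /chk_degrees linear_sum horner_sum.
apply: eq_bigr => k _.
by rewrite linearZ /= derivXn hornerZ hornerMn hornerXn expr1n.
Qed.

Lemma kmax_ge2 : (2 <= kmax E)%N.
Proof.
rewrite leqNgt; apply/negP => k2; have := rho_sum1 E.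
by rewrite /chk_degrees big_geq// => /eqP; rewrite eq_sym oner_eq0.
Qed.

Lemma imax_ge2 : (2 <= imax E)%N.
Proof.
rewrite leqNgt; apply/negP => i2; have := lambda_sum1 E.
by rewrite /var_degrees big_allpairs big_geq// => /eqP; rewrite eq_sym oner_eq0.
Qed.

Lemma chk_slope_ge1 : 1 <= chk_slope.
Proof.
rewrite chk_slopeE -[leLHS](rho_sum1 E) /chk_degrees big_nat_cond [leRHS]big_nat_cond.
apply: ler_sum => k /andP[/andP[k2 _] _].
rewrite -[leLHS]mulr1 ler_wpM2l ?rho_ge0// ler1n; lia.
Qed.

Lemma rho3_ge0 : 0 <= rho3.
Proof. by apply: sumr_ge0 => k _; exact: rho_ge0. Qed.

Lemma rho3_eq0 : rho3 = 0 -> chk_slope = 1.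
Proof.
move=> r0; rewrite chk_slopeE -[RHS](rho_sum1 E) /chk_degrees.
have k2 : (2 < (kmax E).+1)%N by have := kmax_ge2; lia.
rewrite !(big_ltn k2) -/rho3 r0 mulr1 addr0.
rewrite [X in _ + X]big1_seq ?addr0// => k /andP[_ kI].
have /eqP : rho3 == 0 by rewrite r0.
move/eqP; rewrite psumr_eq0; last by move=> i _; exact: rho_ge0.
by move=> /allP/(_ _ kI)/=/eqP ->; rewrite mul0r.
Qed.

(** Every input bit has at least one LT edge, so y^j <= y, and the weights [lambda E 2 j] sum to at
    most 1. *)
Lemma lambda2_le y : 0 <= y -> y <= 1 -> lambda2 y <= y.
Proof.
move=> y0 y1; apply: (@le_trans _ _ (\sum_(1 <= j < (jmax E).+1) lambda E 2 j * y)).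
  rewrite /lambda2 big_nat_cond [leRHS]big_nat_cond.
  apply: ler_sum => j /andP[/andP[j1 _] _].
  rewrite ler_wpM2l ?(lambda_ge0 E (2, j))//.
  by case: j j1 => // j _; rewrite exprS ler_piMr// exprn_ile1.
rewrite -mulr_suml ler_piMl// -(lambda_sum1 E) /var_degrees big_allpairs /=.
rewrite [leRHS]big_ltn; last by have := imax_ge2; lia.
rewrite lerDl; apply: sumr_ge0 => i _; apply: sumr_ge0 => j _.
exact: (lambda_ge0 E (i, j)).
Qed.

Lemma symm_chk_update a : symm a -> symm (chk_update E a).
Proof. by move=> sa; apply: symm_mixture => k; exact: symm_chk_pow. Qed.

Lemma symm_var_update a b : symm a -> symm b -> symm (var_update E a b).
Proof.
move=> sa sb; apply: symm_mixture => ij.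
by apply: symm_var; exact: symm_var_pow.
Qed.

Lemma batta_chk_update a : batta (chk_update E a) <= chk_slope * batta a.
Proof.
rewrite /chk_update batta_mixture chk_slopeE mulr_suml.
by apply: ler_sum => k _; rewrite -mulrA ler_wpM2l ?rho_ge0// batta_chk_pow.
Qed.

Lemma batta_chk_update_gain a (tau : R) : 0 < tau ->
  batta (chk_update E a) + rho3 * (2 * tau * batta a ^+ 2) <=
  chk_slope * batta a + rho3 * (2 * tau ^+ 2 * batta a * mmse a).
Proof.
move=> tau0; rewrite /chk_update batta_mixture chk_slopeE /rho3 !mulr_suml.
have k2 : (2 < (kmax E).+1)%N by have := kmax_ge2; lia.
(* A check node of degree 2 passes on a single message and gains nothing; from degree 3 on, k - 1 >=
   2 messages are combined. *)
rewrite /chk_degrees !(big_ltn k2) -!addrA; apply: lerD.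
  by rewrite -mulrA ler_wpM2l ?rho_ge0// batta_chk_pow.
rewrite -!big_split /= big_nat_cond [leRHS]big_nat_cond.
apply: ler_sum => k /andP[/andP[k3 _] _].
rewrite -mulrDr -(mulrA (rho E k)) -mulrDr ler_wpM2l ?rho_ge0//.
by apply: batta_chk_gain => //; lia.
Qed.

Lemma mmse_chk_update a c : symm a -> symm c ->
  mmse (var_conv (chk_update E a) c) <= chk_slope * mmse (var_conv a c).
Proof.
move=> sa sc; rewrite /chk_update mmse_mixture chk_slopeE mulr_suml.
by apply: ler_sum => k _; rewrite -mulrA ler_wpM2l ?rho_ge0// mmse_chk_pow.
Qed.

(** Degree 2 is the linear part and is kept exactly. The higher degrees have total weight at most 1,
    so a uniform bound suffices for them. *)
Lemma var_degrees_split (F : nat -> nat -> R) (r : R) : 0 <= r ->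
    (forall i j, (3 <= i)%N -> F i j <= r) ->
  \sum_(ij <- var_degrees E) lambda E ij.1 ij.2 * F ij.1 ij.2 <=
  \sum_(1 <= j < (jmax E).+1) lambda E 2 j * F 2%N j + r.
Proof.
move=> r0 Fr; rewrite /var_degrees big_allpairs /=.
have i2 : (2 < (imax E).+1)%N by have := imax_ge2; lia.
rewrite big_ltn// lerD2l.
apply: (@le_trans _ _ (\sum_(3 <= i < (imax E).+1) \sum_(1 <= j < (jmax E).+1) lambda E i j * r)).
  rewrite big_nat_cond [leRHS]big_nat_cond.
  apply: ler_sum => i /andP[/andP[i3 _] _]; apply: ler_sum => j _.
  by rewrite ler_wpM2l ?Fr// (lambda_ge0 E (i, j)).
under eq_bigr do rewrite -mulr_suml.
rewrite -mulr_suml ler_piMl// -(lambda_sum1 E) /var_degrees big_allpairs /=.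
rewrite [leRHS]big_ltn// lerDr; apply: sumr_ge0 => j _.
exact: (lambda_ge0 E (2, j)).
Qed.

Lemma batta_var_update b c : symm b -> symm c ->
  batta (var_update E b c) <= lambda2 (batta c) * batta b + batta b ^+ 2.
Proof.
move=> sb sc; rewrite /var_update batta_mixture.
have spb n := symm_var_pow n sb; have spc n := symm_var_pow n sc.
under eq_bigr => ij _ do rewrite batta_var// !batta_var_pow//.
have /andP[b0 b1] := batta_bound b; have /andP[c0 c1] := batta_bound c.
apply: le_trans (var_degrees_split (F := fun i j => batta b ^+ i.-1 * batta c ^+ j) (sqr_ge0 (batta b)) _) _.
  move=> i j i3; rewrite -[leRHS]mulr1 ler_pM ?exprn_ge0 ?exprn_ile1//.
  by rewrite ler_wiXn2l//; lia.
rewrite lerD2r /lambda2 mulr_suml; apply: ler_sum => j _ /=.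
by rewrite expr1 mulrCA mulrC.
Qed.

(** A node of degree 2 with j LT edges merges its j copies of [c] with the m copies already there.
    At higher degrees, bounding [mmse] by [batta] already leaves a quadratic factor. *)
Lemma mmse_var_update b c m : symm b -> symm c ->
  mmse (var_conv (var_update E b c) (var_pow c m)) <=
  \sum_(1 <= j < (jmax E).+1)
    lambda E 2 j * mmse (var_conv b (var_pow c (j + m))) +
  batta b ^+ 2 * batta c ^+ m.
Proof.
move=> sb sc; rewrite /var_update mmse_mixture.
have /andP[b0 b1] := batta_bound b; have /andP[c0 c1] := batta_bound c.
have spb n := symm_var_pow n sb; have spc n := symm_var_pow n sc.
pose F i j := mmse (var_conv (var_conv (var_pow b i.-1) (var_pow c j)) (var_pow c m)).
have r0 : 0 <= batta b ^+ 2 * batta c ^+ m by rewrite mulr_ge0 ?exprn_ge0.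
apply: le_trans (var_degrees_split (F := F) r0 _) _.
  move=> i j i3; apply: (le_trans (mmse_le_batta _)).
  rewrite !batta_var ?batta_var_pow//; last exact: symm_var.
  rewrite ler_wpM2r ?exprn_ge0// -[leRHS]mulr1 ler_pM ?exprn_ge0 ?exprn_ile1//.
  by rewrite ler_wiXn2l//; lia.
rewrite lerD2r; apply: ler_sum => j _; rewrite /F.
rewrite ler_wpM2l ?(lambda_ge0 E (2, j))// le_eqVlt; apply/orP; left; apply/eqP.
apply: eqlaw_mmse; apply: (eqlaw_trans (eqlaw_varA _ _ _)).
have b1E : eqlaw (var_pow b 2.-1) b := @eqlaw_var0 _ b.
apply: (eqlaw_trans (eqlaw_var1 _ b1E)).
exact: eqlaw_var2 (eqlaw_var_pow _ _ _).
Qed.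

End core_step.

(** * Spreading of the tilted convolution powers *)

Section profile_decay.
Context {R : realType} (b : probability (\bar R) R) (sb : symm b).
Implicit Types (z w : \bar R).

Definition far (s : R) w : R := if w is r%:E then (if s <= `|r| then 1 else 0) else 0.

Lemma measurable_far s : measurable_fun setT (far s).
Proof.
rewrite (_ : far s = fun z => match z with
    r%:E => if s <= `|r| then 1 else 0 | +oo%E => 0 | -oo%E => 0 end); last first.
  by apply/funext => -[r| |].
apply: measurable_case_ereal; apply: measurable_fun_ifT => //.
apply: measurable_fun_ler => //; exact: measurableT_comp.
Qed.

Lemma far_ge0 s w : 0 <= far s w.
Proof. by case: w => //= r; case: ifP. Qed.

Lemma far_le1 s w : far s w <= 1.
Proof. by case: w => //= r; case: ifP. Qed.

(** The tilted mass of [b] at finite distance at least [s] from 0. It is positive for some [s > 0]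
    exactly when [b] charges finite nonzero LLRs. *)
Definition far_mass s : R := fine (\int[b]_w (sech w * far s w)%:E)%E.

Lemma measurable_sech_far s : measurable_fun setT (fun w : \bar R => sech w * far s w).
Proof. by apply: measurable_funM; [exact: measurable_sech|exact: measurable_far]. Qed.

Lemma sech_far_bound s w : 0 <= sech w * far s w <= 1.
Proof.
rewrite mulr_ge0 ?sech_ge0 ?far_ge0//= -[leRHS]mulr1.
by rewrite ler_pM ?sech_ge0 ?far_ge0 ?sech_le1 ?far_le1.
Qed.

Lemma far_massE s : (\int[b]_w (sech w * far s w)%:E = (far_mass s)%:E)%E.
Proof.
by rewrite /far_mass; have [r _ ->] := int_finite b (measurable_sech_far s) (sech_far_bound s).
Qed.

Local Notation y := (batta b).

Definition profile_pow m z : R := fine (profile (var_pow b m) z).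
Local Notation pr := profile_pow.

Lemma measurable_tilt_shift z :
  measurable_fun setT (fun w => tilt w * sech (z + w)%E).
Proof.
apply: measurable_funM; first exact: measurable_tilt.
exact: measurable_shift (@measurable_sech R).
Qed.

Lemma profile_powE m z : profile (var_pow b m) z = (pr m z)%:E.
Proof.
rewrite /pr fineK// ge0_fin_numE; last first.
  by apply: integral_ge0 => w _; rewrite lee_fin mulr_ge0 ?tilt_ge0 ?sech_ge0.
apply: (@le_lt_trans _ _ (\int[var_pow b m]_w (tilt w)%:E)%E).
  apply: ge0_le_int.
  - exact: measurable_tilt_shift.
  - exact: measurable_tilt.
  - by move=> w; rewrite mulr_ge0 ?tilt_ge0 ?sech_ge0.
  - by move=> w; rewrite ler_piMr ?tilt_ge0 ?sech_le1.
by rewrite int_tilt ?ltry//; exact: symm_var_pow.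
Qed.

Lemma profile_pow_ge0 m z : 0 <= pr m z.
Proof.
rewrite fine_ge0//; apply: integral_ge0 => w _.
by rewrite lee_fin mulr_ge0 ?tilt_ge0 ?sech_ge0.
Qed.

Lemma profile_pow_le m z : pr m z <= y ^+ m.
Proof.
rewrite -batta_var_pow// -lee_fin -profile_powE -int_tilt; last exact: symm_var_pow.
apply: ge0_le_int.
- exact: measurable_tilt_shift.
- exact: measurable_tilt.
- by move=> w; rewrite mulr_ge0 ?tilt_ge0 ?sech_ge0.
- by move=> w; rewrite ler_piMr ?tilt_ge0 ?sech_le1.
Qed.

Lemma profile_pow0 z : pr 0 z = sech z.
Proof.
rewrite /pr /profile /var_pow /= int_dirac; last exact: measurable_tilt_shift.
by rewrite adde0 /= mul0r oppr0 expR0 mul1r.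
Qed.

Lemma measurable_profile_pow m : measurable_fun setT (pr m).
Proof.
apply: measurableT_comp => //.
apply: (@measurable_int2 _ _ (fun p => tilt p.2 * sech (p.1 + p.2)%E)).
  apply: measurable_funM; first exact: measurable_comp_snd (@measurable_tilt R).
  exact: measurable_add (@measurable_sech R).
by move=> p; rewrite mulr_ge0 ?tilt_ge0 ?sech_ge0.
Qed.

Lemma measurable_profile_avg m z :
  measurable_fun setT (fun w => sech w * ((pr m (z + w)%E + pr m (z - w)%E) / 2)).
Proof.
have mp := measurable_profile_pow m.
apply: measurable_funM; first exact: measurable_sech.
apply: measurable_funM => //; apply: measurable_funD; first exact: measurable_shift.
by apply: measurableT_comp => //; exact: emeasurable_funB.
Qed.

Lemma profile_avg_ge0 m z w : 0 <= sech w * ((pr m (z + w)%E + pr m (z - w)%E) / 2).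
Proof. by rewrite mulr_ge0 ?sech_ge0// divr_ge0// addr_ge0// profile_pow_ge0. Qed.

(** Tilting is multiplicative, so splitting off one factor averages the profile against the tilted
    law of [b]; this law is even, whence the half-sum over z + w and z - w. *)
Lemma profile_powS m z : ((pr m.+1 z)%:E =
  \int[b]_w (sech w * ((pr m (z + w)%E + pr m (z - w)%E) / 2))%:E)%E.
Proof.
have mp := measurable_profile_pow m.
rewrite -profile_powE {1}/profile [var_pow b _]/= -/(var_conv b (var_pow b m)).
rewrite int_var; last 2 first.
- exact: measurable_tilt_shift.
- by move=> w; rewrite mulr_ge0 ?tilt_ge0 ?sech_ge0.
rewrite -(@symm_tilt _ b (fun w => pr m (z + w)%E) sb); last 2 first.
- exact: measurable_shift.
- by move=> w; exact: profile_pow_ge0.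
apply: eq_integral => w _.
rewrite EFinM -profile_powE /profile -ge0_eq_intZ ?tilt_ge0//; last 2 first.
- exact: measurable_tilt_shift.
- by move=> x; rewrite mulr_ge0 ?tilt_ge0 ?sech_ge0.
by apply: eq_integral => x _; rewrite tiltD addeA mulrA.
Qed.

(** A pointwise bound on the half-sums is integrated against the tilted law of [b], of mass y. The
    term in [kappa] records a deficit that is available only for shifts of size at least [s]. *)
Lemma profile_pow_sum (N m : nat) (zs : nat -> R) (s K kappa : R) :
    0 <= K -> 0 <= kappa ->
    (forall r, \sum_(k < N) ((pr m (zs k + r)%:E + pr m (zs k - r)%:E) / 2) +
       kappa * far s r%:E <= K) ->
  \sum_(k < N) pr m.+1 (zs k)%:E + kappa * far_mass s <= K * y.
Proof.
move=> K0 kappa0 h.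
rewrite -lee_fin EFinD -sumEFin.
under eq_bigr do rewrite profile_powS.
rewrite EFinM -far_massE -ge0_eq_intZ//; last 2 first.
- exact: measurable_sech_far.
- by move=> w; have /andP[] := sech_far_bound s w.
rewrite -(@ge0_integral_sum _ _ _ b setT measurableT _
  (fun (k : 'I_N) w => (sech w * ((pr m ((zs k)%:E + w)%E + pr m ((zs k)%:E - w)%E) / 2))%:E)); last 2 first.
- by move=> k; apply/measurable_EFinP; exact: measurable_profile_avg.
- by move=> k w _; rewrite lee_fin profile_avg_ge0.
under eq_integral do rewrite sumEFin.
rewrite -ge0_eq_intD; last 4 first.
- by apply: measurable_sum => k; exact: measurable_profile_avg.
- by apply: measurable_funM => //; exact: measurable_sech_far.
- by move=> w; apply: sumr_ge0 => k _; exact: profile_avg_ge0.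
- by move=> w; rewrite mulr_ge0//; have /andP[] := sech_far_bound s w.
rewrite EFinM -battaE -ge0_eq_intZ//; last 2 first.
- exact: measurable_sech.
- exact: sech_ge0.
apply: ge0_le_int.
- apply: measurable_funD.
    by apply: measurable_sum => k; exact: measurable_profile_avg.
  by apply: measurable_funM => //; exact: measurable_sech_far.
- by apply: measurable_funM => //; exact: measurable_sech.
- move=> w; rewrite addr_ge0//.
    by apply: sumr_ge0 => k _; exact: profile_avg_ge0.
  by rewrite mulr_ge0//; have /andP[] := sech_far_bound s w.
move=> w; rewrite -mulr_sumr mulrCA -mulrDr mulrC.
(* At infinite w both sides carry a factor [sech w = 0]; the hypothesis concerns finite shifts
   only. *)
case: w => [r| |]; rewrite ?mulr0 ?mul0r//.
by rewrite ler_wpM2r ?sech_ge0//; exact: h.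
Qed.

Definition spaced (s : R) (zs : nat -> R) := forall k, zs k + s <= zs k.+1.

(* [sech z] is at most a multiple of the increment over [z, z + s] of the
   logistic function of [z / 2], so the sum telescopes *)
Lemma sech_sum_spaced (s : R) : 0 < s -> exists2 C : R, 0 <= C &
  forall N zs, spaced s zs -> \sum_(k < N) sech (zs k)%:E <= C.
Proof.
move=> s0; set r := expR (s / 2).
have r1 : 1 < r by rewrite /r -expR0 ltr_expR divr_gt0.
pose C := 4 * r / (r - 1); pose F (x : R) := expR (x / 2) / (1 + expR (x / 2)).
have C0 : 0 <= C by rewrite divr_ge0 ?mulr_ge0 ?subr_ge0 ?ltW// (lt_trans _ r1).
have F01 x : 0 <= F x <= 1.
  rewrite /F; have := expR_gt0 (x / 2); set q := expR _ => q0.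
  have q1 : 0 < 1 + q by lra.
  by rewrite divr_ge0 ?(ltW q0) ?(ltW q1)//= ler_pdivrMr// mul1r; lra.
have Fmono x x' : x <= x' -> F x <= F x'.
  move=> xx; rewrite /F.
  have : expR (x / 2) <= expR (x' / 2) by rewrite ler_expR; lra.
  have := expR_gt0 (x / 2); set q := expR (x / 2); set q' := expR (x' / 2) => q0 qq.
  rewrite ler_pdivrMr; last lra.
  rewrite mulrAC ler_pdivlMr; last lra.
  nra.
have step x : sech x%:E <= C * (F (x + s) - F x).
  rewrite sechE /= /F.
  have -> : (x + s) / 2 = x / 2 + s / 2 by field.
  rewrite expRD -/r.
  have := expR_gt0 (x / 2); set q := expR (x / 2) => q0.
  have r0 : 0 < r by lra.
  have qr0 : 0 < 1 + q * r by nra.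
  have q1 : 0 < 1 + q by lra.
  have -> : C * (q * r / (1 + q * r) - q / (1 + q)) = 4 * r * q / ((1 + q * r) * (1 + q)).
    by rewrite /C; field; rewrite !gt_eqF// subr_gt0.
  rewrite ler_pdivrMr; last nra.
  rewrite mulrAC ler_pdivlMr; last by rewrite mulr_gt0.
  rewrite -subr_ge0.
  have -> : 4 * r * q * (q ^+ 2 + 1) - 2 * q * ((1 + q * r) * (1 + q)) =
    2 * q * (r * (q - 1) ^+ 2 + (r - 1) * (1 + q)) by ring.
  apply: mulr_ge0; first lra.
  by apply: addr_ge0; apply: mulr_ge0; rewrite ?sqr_ge0//; lra.
exists C => // N zs sep.
apply: (@le_trans _ _ (\sum_(k < N) C * (F (zs k.+1) - F (zs k)))).
  apply: ler_sum => k _; apply: (le_trans (step _)).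
  by rewrite ler_wpM2l// lerD2r; exact: Fmono.
rewrite -mulr_sumr -(big_mkord xpredT (fun k => F (zs k.+1) - F (zs k))).
rewrite telescope_sumr//.
have /andP[a0 _] := F01 (zs 0%N); have /andP[_ a1] := F01 (zs N).
rewrite -[leRHS]mulr1 ler_wpM2l//; lra.
Qed.

(** Translating all the points keeps them spaced, so the bound for [sech] passes through each
    averaging step at the cost of a factor y. *)
Lemma profile_pow_spaced (s C : R) : 0 <= C ->
  (forall N zs, spaced s zs -> \sum_(k < N) sech (zs k)%:E <= C) ->
  forall m N zs, spaced s zs -> \sum_(k < N) pr m (zs k)%:E <= C * y ^+ m.
Proof.
move=> C0 hC; elim => [|m ih] N zs sep.
  by rewrite expr0 mulr1; under eq_bigr do rewrite profile_pow0; exact: hC.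
have sh (r : R) : spaced s (fun k => zs k + r).
  by move=> k; rewrite addrAC lerD2r.
have := @profile_pow_sum N m zs s (C * y ^+ m) 0.
rewrite mul0r addr0 exprSr mulrA; apply => //.
  by rewrite mulr_ge0 ?exprn_ge0 ?batta_ge0.
move=> r; rewrite mul0r addr0 -mulr_suml big_split /=.
have := ih N _ (sh r); have := ih N _ (sh (- r)); lra.
Qed.

End profile_decay.

(** * Decay of the normalized profile *)

Section spreading.
Context {R : realType} (b : probability (\bar R) R) (sb : symm b).
Variable s : R.
Hypotheses (s0 : 0 < s) (q0 : 0 < far_mass b s).

Local Notation y := (batta b).
Local Notation q := (far_mass b s).
Local Notation pr := (profile_pow b).

Lemma far_mass_le : q <= y.
Proof.
rewrite -lee_fin -far_massE -battaE; apply: ge0_le_int.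
- exact: measurable_sech_far.
- exact: measurable_sech.
- by move=> w; have /andP[] := sech_far_bound s w.
- by move=> w; rewrite ler_piMr ?sech_ge0 ?far_le1.
Qed.

Lemma batta_gt0 : 0 < y.
Proof. exact: lt_le_trans q0 far_mass_le. Qed.

Definition below (t : R) := exists m, forall r : R, pr m r%:E <= t * y ^+ m.

(** An average over translates does not exceed the supremum: the supremum of [pr n] divided by y^n
    is nonincreasing in n. *)
Lemma below_mono (t : R) m : 0 <= t -> (forall r : R, pr m r%:E <= t * y ^+ m) ->
  forall n, (m <= n)%N -> forall r : R, pr n r%:E <= t * y ^+ n.
Proof.
move=> t0 h n; rewrite leq_eqVlt => /predU1P[<- //|]; elim: n => // n ih.
rewrite ltnS leq_eqVlt => mn r.
have {mn ih}ih (r' : R) : pr n r'%:E <= t * y ^+ n.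
  by case/predU1P: mn => [<- //|/ih].
have := @profile_pow_sum _ b sb 1 n (fun=> r) s (t * y ^+ n) 0.
rewrite big_ord1 mul0r addr0 exprSr mulrA; apply => //.
  by rewrite mulr_ge0 ?exprn_ge0 ?batta_ge0.
move=> r'; rewrite big_ord1 mul0r addr0.
by have := ih (r + r'); have := ih (r - r'); lra.
Qed.

Section level.
(** [L] stands for the limit of these normalized suprema: it is approached from above eventually,
    and no step falls below it. *)
Variable L : R.
Hypothesis upper : forall e, 0 < e -> exists m0, forall m, (m0 <= m)%N ->
  forall r : R, pr m r%:E <= (L + e) * y ^+ m.
Hypothesis lower : forall e, 0 < e -> e < L -> forall m,
  exists r : R, (L - e) * y ^+ m <= pr m r%:E.

(* If the profile nearly attains its supremum at given spaced points then, one
   step earlier, it does so at all their translates by [r] and by [- r] for some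
   [r >= s]; keeping one left translate and all the right ones adds a point. *)
Lemma many_peaks N (e : R) m0 : 0 < e -> e < L -> exists2 m, (m0 <= m)%N &
  exists2 zs, spaced s zs & forall k, (k <= N)%N -> (L - e) * y ^+ m <= pr m (zs k)%:E.
Proof.
elim: N e m0 => [|N ih] e m0 e0 eL.
  have [r hr] := lower e0 eL m0; exists m0 => //.
  (* Only index 0 has to be a peak; the other points merely keep the sequence spaced. *)
  exists (fun k => r + k%:R * s); first by move=> k; rewrite -natr1; lra.
  by move=> k; rewrite leqn0 => /eqP ->; rewrite mul0r addr0.
have y0 := batta_gt0; have qy := far_mass_le.
pose n : R := N.+1%:R; have n1 : 1 <= n by rewrite ler1n.
have n0 : 0 < n by lra.
(* Over n points of height within e' of L, the slack is 2 n e' y = e q / 4, which is less than the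
   deficit e q / 2 caused by the far mass if some translate misses its level by e. *)
pose e' := e * q / (8 * n * y).
have D0 : 0 < 8 * n * y by rewrite !mulr_gt0.
have e'E : e' * (8 * n * y) = e * q by rewrite /e' divfK// gt_eqF.
have e'0 : 0 < e' by rewrite divr_gt0 ?mulr_gt0.
have e'e : e' <= e.
  by rewrite /e' ler_pdivrMr// ler_wpM2l ?(ltW e0)//; nra.
have [m1 hm1] := upper e'0.
(* The peaks are requested at a positive step past both thresholds, so that the upper bound already
   holds at the preceding step m. *)
have [[//|m] mm0 [zs sep hz]] := ih e' (maxn m0 m1).+1 e'0 (le_lt_trans e'e eL).
have {mm0} /andP[mm0 mm1] : (m0 <= m)%N && (m1 <= m)%N by rewrite -geq_max -ltnS.
have ym0 : 0 < y ^+ m by rewrite exprn_gt0.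
have up r := hm1 m mm1 r.
have [r [rs hr]] : exists r, s <= r /\ forall k, (k <= N)%N ->
    (L - e) * y ^+ m <= pr m (zs k + r)%:E /\ (L - e) * y ^+ m <= pr m (zs k - r)%:E.
  apply: contrapT => nex.
  have far_gap (r : R) : s <= r -> exists k : 'I_N.+1,
      pr m (zs k + r)%:E + pr m (zs k - r)%:E <= (L - e + (L + e')) * y ^+ m.
    move=> sr; apply: contrapT => nk; apply: nex; exists r; split => // k kN.
    apply: contrapT => nh; apply: nk; exists (Ordinal (kN : (k < N.+1)%N)) => /=.
    have u1 := up (zs k + r); have u2 := up (zs k - r).
    rewrite mulrDl; case: (leP ((L - e) * y ^+ m) (pr m (zs k + r)%:E)) => h1.
      case: (leP ((L - e) * y ^+ m) (pr m (zs k - r)%:E)) => h2; last by lra.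
      by exfalso; apply: nh.
    by lra.
  have := @profile_pow_sum _ b sb N.+1 m zs s (n * (L + e') * y ^+ m) (e / 2 * y ^+ m).
  have K0 : 0 <= n * (L + e') * y ^+ m by rewrite !mulr_ge0// ?ltW//; lra.
  have k0 : 0 <= e / 2 * y ^+ m by rewrite mulr_ge0// ?ltW//; lra.
  move=> /(_ K0 k0) hsum.
  have {hsum} hsum : \sum_(k < N.+1) pr m.+1 (zs k)%:E + e / 2 * y ^+ m * q
      <= n * (L + e') * y ^+ m * y.
    apply: hsum => r.
    have term (k : 'I_N.+1) : (pr m (zs k + r)%:E + pr m (zs k - r)%:E) / 2 <= (L + e') * y ^+ m.
      by have := up (zs k + r); have := up (zs k - r); lra.
    have card (P : pred 'I_N.+1) (x : R) : \sum_(k | P k) x = #|P|%:R * x.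
      by rewrite sumr_const mulr_natl.
    rewrite /far; case: ifP => sr; last first.
      rewrite mulr0 addr0 (le_trans (ler_sum _ (fun k _ => term k)))//.
      by rewrite card cardT size_enum_ord mulrA.
    (* For r <= -s the two translates exchange their roles, and [far_gap] applies to the absolute
       value. *)
    have [k hk] : exists k : 'I_N.+1,
        pr m (zs k + r)%:E + pr m (zs k - r)%:E <= (L - e + (L + e')) * y ^+ m.
      have [k hk] := far_gap _ sr; exists k; move: hk.
      by case: (ger0P r) => _ //; rewrite opprK addrC.
    rewrite (bigD1 k)//=.
    have : \sum_(i < N.+1 | i != k) (pr m (zs i + r)%:E + pr m (zs i - r)%:E) / 2
        <= (n - 1) * ((L + e') * y ^+ m).
      apply: (le_trans (ler_sum _ (fun i _ => term i))).
      rewrite card cardC1 card_ord /= /n -natr1; lra.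
    have : 0 <= e' * y ^+ m by rewrite mulr_ge0 ?ltW.
    move: hk; rewrite -mulrA; move: ((L + e') * y ^+ m) (y ^+ m) => A B; nra.
  have lowsum : n * ((L - e') * y ^+ m.+1) <= \sum_(k < N.+1) pr m.+1 (zs k)%:E.
    rewrite /n mulr_natl -[X in _ *+ X]card_ord -sumr_const.
    by apply: ler_sum => k _; apply: hz; rewrite -ltnS.
  have : n * ((L - e') * (y ^+ m * y)) + e / 2 * y ^+ m * q <= n * (L + e') * y ^+ m * y.
    by rewrite -exprSr; apply: le_trans hsum; rewrite lerD2r.
  have -> : n * ((L - e') * (y ^+ m * y)) + e / 2 * y ^+ m * q =
     n * (L + e') * y ^+ m * y + y ^+ m * (e * q / 2 - e' * (8 * n * y) / 4) by field.
  rewrite e'E gerDl.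
  by have : 0 < y ^+ m * (e * q / 2 - e * q / 4);
    [rewrite mulr_gt0//; have := mulr_gt0 e0 q0; lra|rewrite ltNge => /negP].
(* The added point zs 0 - r lies 2 r >= s below its neighbour zs 0 + r. *)
exists m => //; exists (fun k => if k is k'.+1 then zs k' + r else zs 0%N - r).
  by move=> [|k] /=; [have := s0; lra|have := sep k; lra].
by move=> [|k] kN; [have [] := hr 0%N (leq0n N)|have [] := hr k kN].
Qed.

End level.

(** Otherwise the limiting level L is positive and [many_peaks] yields, for any N, N + 1 spaced
    points of height at least (L / 2) y^m, while the sum over spaced points is at most C y^m. *)
Lemma profile_pow_decay (delta : R) : 0 < delta ->
  exists m, forall n, (m <= n)%N -> forall r : R, pr n r%:E <= delta * y ^+ n.
Proof.
move=> d0; suff [m hm] : below delta.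
  by exists m; exact: below_mono (ltW d0) hm.
apply: contrapT => nb.
pose S := [set t : R | 0 <= t /\ below t].
have S1 : S 1.
  split => //; exists 0%N => r; rewrite mul1r; exact: profile_pow_le.
have Sdelta : lbound S delta.
  move=> t [t0 [m hm]]; rewrite leNgt; apply/negP => td; apply: nb.
  exists m => r; apply: (le_trans (hm r)).
  by rewrite ler_wpM2r ?exprn_ge0 ?batta_ge0// ltW.
have hS : has_inf S by split; [exists 1|exists delta].
pose L := inf S.
have dL : delta <= L by apply: lb_le_inf Sdelta; exists 1.
have L0 : 0 < L by exact: lt_le_trans dL.
have [C C0 hC] := sech_sum_spaced s0.
have upper e : 0 < e -> exists m0, forall m, (m0 <= m)%N ->
    forall r : R, pr m r%:E <= (L + e) * y ^+ m.
  move=> e0; have [t [t0 [m0 hm0]] tL] := inf_adherent e0 hS.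
  exists m0 => m mm r; apply: (le_trans (below_mono t0 hm0 mm r)).
  by rewrite ler_wpM2r ?exprn_ge0 ?batta_ge0// ltW.
have lower e : 0 < e -> e < L -> forall m,
    exists r : R, (L - e) * y ^+ m <= pr m r%:E.
  move=> e0 eL m; apply: contrapT => nex.
  have : S (L - e).
    split; first lra; exists m => r; rewrite leNgt; apply/negP => h.
    by apply: nex; exists r; exact: ltW.
  by move=> /(ge_inf hS.2); rewrite -/L; lra.
have [N hN] : exists N : nat, C < L / 2 * N.+1%:R.
  exists (Num.truncn (C / (L / 2))); have := truncnS_gt (C / (L / 2)).
  by rewrite ltr_pdivrMr ?divr_gt0// mulrC.
have L2 : 0 < L / 2 by lra.
have L2L : L / 2 < L by lra.
have [m _ [zs sep hz]] := many_peaks upper lower N 0 L2 L2L.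
have := profile_pow_spaced sb C0 hC m N.+1 sep.
rewrite leNgt => /negP; apply.
apply: (@lt_le_trans _ _ (L / 2 * N.+1%:R * y ^+ m)).
  by rewrite ltr_pM2r ?exprn_gt0 ?batta_gt0.
rewrite (_ : _ * _ * _ = (L - L / 2) * y ^+ m *+ N.+1); last first.
  by rewrite -mulr_natr; field.
rewrite -[X in _ *+ X]card_ord -sumr_const.
by apply: ler_sum => k _; apply: hz; rewrite -ltnS.
Qed.

End spreading.

(** * Convergence of the recursion *)

Section recursion.
Context {R : realType}.

(** Let L be the infimum of the eventual upper bounds of x. If L were positive, either alternative,
    applied to an eventual bound t close enough to L, would give an eventual bound below L. *)
Lemma delayed_recursion_vanishes (x : nat -> R) (K eta eps : R) n :
    0 < K -> 0 < eta -> eta <= 1 -> 0 < eps -> 2 * K * eps <= 1 ->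
    (forall l, 0 <= x l) ->
    (forall l, x l <= eps -> x l.+1 <= 2 * x l) ->
    (forall l, (forall i, (i <= n)%N -> x (l + i)%N <= eps) ->
      x (l + n).+1 <= x (l + n)%N - K * x (l + n)%N ^+ 2 \/
      x (l + n).+1 <= (1 - eta) * x l) ->
    2 ^+ n * x 0%N <= eps ->
  forall delta, 0 < delta -> exists N, forall l, (N <= l)%N -> x l <= delta.
Proof.
move=> K0 eta0 eta1 eps0 Keps x0 x2 xn xinit.
(* The first n + 1 terms are controlled by doubling from x_0; every later term is covered by one of
   the alternatives, neither of which exceeds eps. *)
have window l : forall i, (i <= n)%N -> x (l + i)%N <= eps.
  elim: l => [|l ih] i iN.
    have p i' : (i' <= n)%N -> x i' <= 2 ^+ i' * x 0%N.
      elim: i' => [|i' ih] i'n; first by rewrite expr0 mul1r.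
      have h := ih (ltnW i'n); apply: (le_trans (x2 _ _)).
        apply: (le_trans h); apply: le_trans xinit.
        by rewrite ler_wpM2r// ler_weXn2l ?ler1n// ltnW.
      by rewrite exprS -mulrA ler_wpM2l.
    apply: (le_trans (p _ iN)); apply: le_trans xinit.
    by rewrite ler_wpM2r// ler_weXn2l ?ler1n.
  move: iN; rewrite leq_eqVlt => /predU1P[->|iN]; last by rewrite addSnnS ih.
  rewrite addSn; have e1 := ih n (leqnn n); have e2 := ih 0%N (leq0n n).
  rewrite addn0 in e2; have x1 := x0 l.
  case: (xn l ih) => h; apply: (le_trans h).
    by have := sqr_ge0 (x (l + n)%N); nra.
  by nra.
have xeps l : x l <= eps by have := window l 0%N (leq0n n); rewrite addn0.
pose S := [set t : R | t <= eps /\ exists N, forall l, (N <= l)%N -> x l <= t].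
have Seps : S eps by split => //; exists 0%N.
have Slb : lbound S 0.
  by move=> t [_ [N hN]]; exact: le_trans (x0 N) (hN N (leqnn N)).
have hS : has_inf S by split; [exists eps|exists 0].
pose L := inf S; have L0 : 0 <= L by apply: lb_le_inf Slb; exists eps.
have [Leq|Lneq] := eqVneq L 0.
  move=> delta d0; have [t [_ [N hN]] td] := inf_adherent d0 hS.
  by exists N => l Nl; apply: (le_trans (hN l Nl)); move: td; rewrite -/L Leq add0r => /ltW.
have {Lneq} {}L0 : 0 < L by rewrite lt_neqAle eq_sym Lneq.
exfalso.
(* For L <= t < L + e, both t - K t^2 and (1 - eta) t are below L. *)
pose e := Num.min (K * L ^+ 2) (eta * L).
have e0 : 0 < e by rewrite lt_min !mulr_gt0 ?exprn_gt0.
have e1 : e <= K * L ^+ 2 by rewrite ge_min lexx.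
have e2 : e <= eta * L by rewrite ge_min lexx orbT.
have [t tS tL] := inf_adherent e0 hS; rewrite -/L in tL.
have Lt : L <= t by exact: ge_inf hS.2 _ tS.
case: tS => teps [N hN].
have t0 : 0 < t by lra.
pose g := Num.max (t - K * t ^+ 2) ((1 - eta) * t).
have gL : g < L.
  rewrite gt_max; apply/andP; split; last by nra.
  have : L ^+ 2 <= t ^+ 2 by rewrite ler_pXn2r ?nnegrE// ltW.
  by nra.
suff : S g by move=> /(ge_inf hS.2); rewrite -/L; lra.
split; first by lra.
exists (N + n).+1 => l Nl.
have [l' lE] : exists l', l = (l' + n).+1.
  exists (l - n.+1)%N; rewrite -addnS subnK//.
  by apply: leq_trans Nl; rewrite ltnS leq_addl.
move: Nl; rewrite lE ltnS leq_add2r => Nl'.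
have h1 := hN l' Nl'; have h2 := hN (l' + n)%N (leq_trans Nl' (leq_addr _ _)).
rewrite le_max; case: (xn l' (window l')) => h; apply/orP; [left|right]; apply: (le_trans h).
  (* The map u -> u - K u^2 is nondecreasing up to 1 / (2 K) >= eps, so u may be replaced by its
     bound t. *)
  have := x0 (l' + n)%N; move: (x (l' + n)%N) h2 => u ut u0.
  rewrite -subr_ge0 (_ : _ - _ = (t - u) * (1 - K * (t + u))); last by ring.
  by rewrite mulr_ge0 ?subr_ge0//; nra.
by rewrite ler_wpM2l// subr_ge0.
Qed.

Lemma sech_far_lt (s : R) (w : \bar R) : 0 < s ->
  sech w + (1 - sech s%:E) * (sech w * far s w) <= 1.
Proof.
move=> s0; have s1 := sech_le1 s%:E; have s0' := sech_ge0 s%:E.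
case: w => [r| |]; rewrite /= ?mul0r ?mulr0 ?addr0 ?ler01//.
rewrite -!/(sech _%:E); have r1 := sech_le1 r%:E; have r0 := sech_ge0 r%:E.
case: ifP => sr; last by rewrite !mulr0 addr0.
have : sech r%:E <= sech s%:E.
  have -> : sech r%:E = sech `|r|%:E.
    by case: (ger0P r) => // _; rewrite EFinN sechN.
  rewrite !sechE /=.
  have : expR (s / 2) <= expR (`|r| / 2) by rewrite ler_expR; lra.
  have : 1 < expR (s / 2) by rewrite expR_gt1; lra.
  set p := expR (s / 2); set q := expR (`|r| / 2) => p1 pq.
  rewrite ler_pdivrMr; last nra.
  rewrite mulrAC ler_pdivlMr; last nra.
  rewrite -subr_ge0 (_ : _ - _ = 2 * (q - p) * (p * q - 1)); last by ring.
  by rewrite mulr_ge0//; nra.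
by rewrite mulr1; nra.
Qed.

Lemma batta_lt1 (b : probability (\bar R) R) s : 0 < s -> 0 < far_mass b s ->
  batta b < 1.
Proof.
move=> s0 q0.
have k0 : 0 < 1 - sech s%:E.
  rewrite sechE /=.
  have : 1 < expR (s / 2) by rewrite expR_gt1; lra.
  set p := expR (s / 2) => p1.
  by rewrite subr_gt0 ltr_pdivrMr; nra.
suff : batta b + (1 - sech s%:E) * far_mass b s <= 1.
  by have := mulr_gt0 k0 q0; lra.
rewrite -lee_fin EFinD -battaE EFinM -far_massE.
have mf := measurable_sech_far s.
have f0 w : 0 <= sech w * far s w by have /andP[] := sech_far_bound s w.
rewrite -ge0_eq_intZ ?(ltW k0)// -ge0_eq_intD; last 4 first.
- exact: measurable_sech.
- exact: measurable_funM.
- exact: sech_ge0.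
- by move=> w; rewrite mulr_ge0// ltW.
rewrite -(int_cst b 1%:E); apply: ge0_le_int => //.
- by apply: measurable_funD; [exact: measurable_sech|exact: measurable_funM].
- by move=> w; rewrite addr_ge0 ?sech_ge0// mulr_ge0// ltW.
- by move=> w; exact: sech_far_lt.
Qed.

End recursion.

(** * Density evolution under the stability condition *)

Section core_convergence.
Context {R : realType} (E : @core_ensemble R) (b : probability (\bar R) R).
Hypothesis sb : symm b.
Implicit Types a : probability (\bar R) R.

Local Notation A := (chk_slope E).
Local Notation y := (batta b).
(** Only the variable-node factor: the quantity compared with 1 is [S * A]. *)
Local Notation S := (lambda2 E y).
Local Notation c := (rho3 E).

Hypothesis stable : S * A <= 1.

Let A1 : 1 <= A := chk_slope_ge1 E.
Let y0 : 0 <= y := batta_ge0 b.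
Let S0 : 0 <= S.
Proof.
apply: sumr_ge0 => j _; rewrite mulr_ge0 ?exprn_ge0//.
exact: (lambda_ge0 E (2, j)).
Qed.

Let next a := var_update E (chk_update E a) b.

Let symm_next a : symm a -> symm (next a).
Proof. by move=> sa; apply: symm_var_update => //; exact: symm_chk_update. Qed.

Lemma batta_next a : symm a ->
  batta (next a) <= S * batta (chk_update E a) + A ^+ 2 * batta a ^+ 2.
Proof.
move=> sa; apply: (le_trans (batta_var_update _ (symm_chk_update E sa) sb)).
rewrite lerD2l -exprMn; have h := batta_chk_update E a.
by rewrite ler_pXn2r ?nnegrE ?batta_ge0// (le_trans _ h) ?batta_ge0.
Qed.

Lemma batta_next_linear a : symm a ->
  batta (next a) <= S * A * batta a + A ^+ 2 * batta a ^+ 2.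
Proof.
move=> sa; apply: (le_trans (batta_next sa)); rewrite lerD2r -mulrA.
by rewrite ler_wpM2l// batta_chk_update.
Qed.

Lemma batta_next_gain a (tau : R) : symm a -> 0 < tau ->
  batta (next a) <= batta a + A ^+ 2 * batta a ^+ 2
    - S * c * (2 * tau * batta a ^+ 2 - 2 * tau ^+ 2 * batta a * mmse a).
Proof.
move=> sa tau0; apply: (le_trans (batta_next sa)).
have h := batta_chk_update_gain E a tau0.
have {h} h : batta (chk_update E a) <= A * batta a -
   c * (2 * tau * batta a ^+ 2 - 2 * tau ^+ 2 * batta a * mmse a) by lra.
have h1 := ler_wpM2l S0 h.
have h2 : S * (A * batta a) <= batta a by rewrite mulrA ler_piMl ?batta_ge0.
by move: h1; rewrite mulrBr !mulrA -!mulrA; move: h2; rewrite !mulrA; lra.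
Qed.

Lemma mmse_next a m : symm a ->
  mmse (var_conv (next a) (var_pow b m)) <=
  \sum_(1 <= j < (jmax E).+1)
    lambda E 2 j * (A * mmse (var_conv a (var_pow b (j + m)))) +
  A ^+ 2 * batta a ^+ 2 * y ^+ m.
Proof.
move=> sa; apply: (le_trans (mmse_var_update E m (symm_chk_update E sa) sb)).
apply: lerD.
  apply: ler_sum => j _; rewrite ler_wpM2l ?(lambda_ge0 E (2, j))//.
  by apply: mmse_chk_update => //; exact: symm_var_pow.
rewrite ler_wpM2r ?exprn_ge0// -exprMn; have h := batta_chk_update E a.
by rewrite ler_pXn2r ?nnegrE ?batta_ge0// (le_trans _ h) ?batta_ge0.
Qed.

(** Each iteration supplies j >= 1 further copies of [b], so the number m of copies still required
    drops as i grows: n <= i + m is the invariant, and i = n allows m = 0. The factors y^j recombine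
    into [S], and [S * A <= 1] keeps the constant; only the quadratic terms accumulate. *)
Lemma mmse_iter (n : nat) (d X : R) (a : nat -> probability (\bar R) R) (xi : R) :
    (forall l, symm (a l)) -> (forall l, a l.+1 = next (a l)) ->
    (forall m, (n <= m)%N -> mmse (var_conv (a 0%N) (var_pow b m)) <= d * xi * y ^+ m) ->
    0 <= d * xi ->
    (forall i, (i < n)%N -> batta (a i) <= X) ->
  forall i m, (i <= n)%N -> (n <= i + m)%N ->
    mmse (var_conv (a i) (var_pow b m)) <= (d * xi + i%:R * (A ^+ 2 * X ^+ 2)) * y ^+ m.
Proof.
move=> sa aS a0 dx0 aX; elim => [|i ih] m iN nim.
  by rewrite mul0r addr0; exact: a0.
rewrite aS; apply: (le_trans (mmse_next m (sa i))).
have Xi := aX i iN; have xi0 := batta_ge0 (a i).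
set B := d * xi + i%:R * (A ^+ 2 * X ^+ 2).
have B0 : 0 <= B.
  by rewrite addr_ge0// mulr_ge0// mulr_ge0// sqr_ge0.
apply: (@le_trans _ _ (S * A * (B * y ^+ m) + A ^+ 2 * X ^+ 2 * y ^+ m)).
  apply: lerD; last first.
    rewrite ler_wpM2r ?exprn_ge0// ler_wpM2l ?sqr_ge0//.
    by rewrite ler_pXn2r ?nnegrE// (le_trans xi0).
  rewrite /lambda2 -mulrA mulr_suml big_nat_cond [leRHS]big_nat_cond.
  apply: ler_sum => j /andP[/andP[j1 _] _].
  have -> : lambda E 2 j * y ^+ j * (A * (B * y ^+ m)) = lambda E 2 j * (A * (B * y ^+ (j + m))).
    by rewrite exprD; ring.
  rewrite ler_wpM2l ?(lambda_ge0 E (2, j))// ler_wpM2l ?(le_trans ler01 A1)//.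
  apply: ih; first exact: ltnW.
  by apply: (leq_trans nim); rewrite addSnnS leq_add2l -add1n leq_add2r.
have : S * A * (B * y ^+ m) <= B * y ^+ m by rewrite ler_piMl// mulr_ge0// exprn_ge0.
by rewrite /B -natr1; lra.
Qed.

Lemma core_evolution_vanishes (s : R) : 0 < s -> 0 < far_mass b s ->
  exists2 eps : R, 0 < eps & forall a, symm a -> batta a <= eps ->
    forall delta, 0 < delta -> exists N, forall l, (N <= l)%N ->
      batta (core_density_evolution E b a l) <= delta.
Proof.
move=> s0 q0; pose K := A ^+ 2.
have K1 : 1 <= K by rewrite /K exprn_ege1.
have K0 : 0 < K by lra.
have sa (a : probability (\bar R) R) l : symm a -> symm (core_density_evolution E b a l).
  by move=> sa; elim: l => // l ih; exact: symm_next.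
have xS (a : probability (\bar R) R) l : symm a ->
    batta (core_density_evolution E b a l.+1) <=
    S * A * batta (core_density_evolution E b a l) +
    K * batta (core_density_evolution E b a l) ^+ 2.
  by move=> h; exact: batta_next_linear (sa _ _ h).
have [SA|SA] := ltP (S * A) 1.
  pose eta := (1 - S * A) / 2; pose eps := eta / K.
  have SA0 : 0 <= S * A by rewrite mulr_ge0// (le_trans ler01).
  have eta0 : 0 < eta by rewrite /eta; lra.
  have eps0 : 0 < eps by rewrite divr_gt0.
  have epsK : K * eps = eta by rewrite /eps mulrC divfK// gt_eqF.
  exists eps => // a ha xa.
  pose x l := batta (core_density_evolution E b a l).
  have x0 l : 0 <= x l := batta_ge0 _.
  have step l : x l <= eps -> x l.+1 <= (1 - eta) * x l.
    move=> xl; apply: (le_trans (xS a l ha)); rewrite -/(x l).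
    have : K * x l ^+ 2 <= eta * x l.
      by rewrite -epsK expr2 mulrA ler_wpM2r// ler_wpM2l// ltW.
    by rewrite /eta; lra.
  apply: (@delayed_recursion_vanishes _ x K eta eps 0) => //.
  - by rewrite /eta; lra.
  - by rewrite -mulrA epsK /eta; lra.
  - by move=> l xl; apply: (le_trans (step l xl)); have := x0 l; nra.
  - move=> l h; right; rewrite addn0; apply: step.
    by have := h 0%N (leqnn _); rewrite addn0.
  - by rewrite expr0 mul1r.
have {SA} SA : S * A = 1 by apply/eqP; rewrite eq_le stable.
have y1 : y < 1 by exact: batta_lt1 s0 q0.
have yp : 0 < y by exact: batta_gt0 q0.
have S1 : S <= y by apply: lambda2_le => //; exact: ltW.
(* With all check nodes of degree 2, A = 1 and S A <= y < 1, a contradiction. *)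
have c0 : 0 < c.
  rewrite lt_neqAle eq_sym rho3_ge0 andbT; apply/eqP => /rho3_eq0 A1'.
  by move: SA; rewrite A1' mulr1; lra.
have Sp : 0 < S.
  by rewrite lt_neqAle eq_sym S0 andbT; apply/eqP => S0'; move: SA; rewrite S0' mul0r; lra.
(* Once v <= 4 d x, the choice tau = 1 / (8 d) makes the gain equal to S c x^2 / (8 d) = 2 K x^2,
   twice the quadratic loss. *)
pose d := S * c / (16 * K).
have d0 : 0 < d by apply: divr_gt0; [exact: mulr_gt0|by rewrite mulr_gt0].
have [n hn] := profile_pow_decay sb s0 q0 d0.
(* Coefficient of the quadratic errors accumulated over n iterations, during which x grows by at
   most 2^n. *)
pose M : R := n%:R * (K * (2 ^+ n) ^+ 2).
have M0 : 0 <= M.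
  by rewrite /M mulr_ge0// mulr_ge0 ?sqr_ge0// ltW.
pose eps := Num.min (1 / (2 * K)) (d / (1 + M)).
have eps0 : 0 < eps.
  rewrite lt_min; apply/andP; split; apply: divr_gt0 => //; last lra.
  by rewrite mulr_gt0.
have epsK : 2 * K * eps <= 1.
  have K2 : 0 < 2 * K by lra.
  by rewrite mulrC -(ler_pdivlMr _ _ K2) /eps ge_min lexx.
have epsM : M * eps <= d.
  apply: (@le_trans _ _ (eps * (1 + M))); first by nra.
  have M1 : 0 < 1 + M by lra.
  by rewrite -(ler_pdivlMr _ _ M1) /eps ge_min lexx orbT.
have p2 : 0 < 2 ^+ n :> R by rewrite exprn_gt0.
exists (eps / 2 ^+ n); first by rewrite divr_gt0.
move=> a ha xa.
pose al l := core_density_evolution E b a l.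
pose x l := batta (al l).
have x0 l : 0 <= x l := batta_ge0 _.
have step l : x l.+1 <= x l + K * x l ^+ 2.
  by apply: (le_trans (xS a l ha)); rewrite SA mul1r.
have xsq l : x l <= eps -> K * x l ^+ 2 <= x l / 2.
  by move=> xl; have := x0 l; nra.
apply: (@delayed_recursion_vanishes _ x K (1 / 4) eps n) => //.
- by lra.
- by move=> l xl; apply: (le_trans (step l)); have := xsq l xl; have := x0 l; lra.
- move=> l h.
  have grow i : (i <= n)%N -> x (l + i)%N <= 2 ^+ n * x l.
    move=> iN; apply: (@le_trans _ _ (2 ^+ i * x l)); last first.
      by rewrite ler_wpM2r// ler_weXn2l ?ler1n.
    elim: i iN => [|i ih] iN; first by rewrite addn0 expr0 mul1r.
    have := ih (ltnW iN); have := xsq _ (h i (ltnW iN)); have := step (l + i)%N.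
    rewrite addnS [2 ^+ i.+1]exprS -[2 * _ * x l]mulrA; move: (2 ^+ i * x l) => u.
    by have := x0 (l + i)%N; lra.
  (* If x has halved, one more iteration loses at most a factor 3/2, which leaves 3/4 of x l.
     Otherwise x l <= 2 x (l + n), and a bound on [mmse] by x l becomes one by x (l + n). *)
  have [small|big] := ltP (x (l + n)%N) (x l / 2).
    by right; have := step (l + n)%N; have := xsq _ (h n (leqnn n)); lra.
  left.
  have xl : x l <= eps by have := h 0%N (leq0n n); rewrite addn0.
  have dx0 : 0 <= d * x l by rewrite mulr_ge0// ltW.
  have V : mmse (var_conv (al (l + n)%N) (var_pow b 0)) <= d * x l + M * x l ^+ 2.
    have := @mmse_iter n d (2 ^+ n * x l) (fun i => al (l + i)%N) (x l).
    move=> /(_ (fun i => sa a (l + i)%N ha)) hit.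
    have {}hit := hit (fun i => congr1 al (addnS l i)).
    have {}hit : mmse (var_conv (al (l + n)%N) (var_pow b 0)) <=
        (d * x l + n%:R * (A ^+ 2 * (2 ^+ n * x l) ^+ 2)) * y ^+ 0.
      apply: hit => //; last by rewrite addn0.
        (* The decay of the profile enters here, at the initial index and for every m >= n. *)
        move=> m nm; rewrite addn0 mulrAC.
        apply: mmse_profile; [exact: sa|exact: symm_var_pow|].
        by move=> r; rewrite profile_powE// lee_fin; exact: hn.
      by move=> i iN; exact: grow (ltnW iN).
    by apply: (le_trans hit); rewrite expr0 mulr1 exprMn /M /K !mulrA.
  have {V} V : mmse (al (l + n)%N) <= 4 * d * x (l + n)%N.
    rewrite (eqlaw_mmse (@eqlaw_var0 _ _)) in V.
    have : M * x l ^+ 2 <= d * x l.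
      apply: (@le_trans _ _ (M * eps * x l)); last by rewrite ler_wpM2r.
      by rewrite expr2 mulrA ler_wpM2r// ler_wpM2l.
    have : d * x l <= d * (2 * x (l + n)%N) by rewrite ler_wpM2l ?(ltW d0)//; lra.
    by lra.
  have tau0 : 0 < 1 / (8 * d) by rewrite divr_gt0// mulr_gt0.
  have := batta_next_gain (sa a (l + n)%N ha) tau0.
  rewrite -/(al (l + n)%N) -/(x (l + n)%N) -/K.
  have -> : next (al (l + n)%N) = al (l + n).+1 by [].
  rewrite -/(x (l + n).+1) => h1; apply: (le_trans h1).
  set z := x (l + n)%N; set t := 1 / (8 * d).
  have z0 : 0 <= z := x0 _.
  have tz : 2 * t ^+ 2 * z * mmse (al (l + n)%N) <= 2 * t ^+ 2 * z * (4 * d * z).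
    by rewrite ler_wpM2l// mulr_ge0// mulr_ge0// sqr_ge0.
  have e1 : 2 * t * z ^+ 2 - 2 * t ^+ 2 * z * (4 * d * z) = z ^+ 2 / (8 * d).
    by rewrite /t; field; rewrite gt_eqF.
  have e2 : S * c * (z ^+ 2 / (8 * d)) = 2 * K * z ^+ 2.
    by rewrite /d; field; rewrite !gt_eqF.
  have : S * c * (z ^+ 2 / (8 * d)) <=
      S * c * (2 * t * z ^+ 2 - 2 * t ^+ 2 * z * mmse (al (l + n)%N)).
    have Sc0 : 0 <= S * c by apply: mulr_ge0; exact: ltW.
    by rewrite ler_wpM2l// -e1 lerD2l lerN2.
  by rewrite e2; lra.
- by rewrite mulrC -ler_pdivlMr.
Qed.

End core_convergence.

(** * Initial density and error rate *)

Section symmetric_density.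
Context {R : realType}.
Implicit Types (a : probability (\bar R) R) (z w : \bar R) (f : \bar R -> R).

Let finite_llr : set (\bar R) := EFin @` setT.

Let measurable_finite_llr : measurable finite_llr.
Proof. by apply: measurable_image_EFin; exact: measurableT. Qed.

(** Symmetry says that the reflection of [a], restricted to finite LLRs, has density e^(-z) with
    respect to [a]. Written as [tilt z ^+ 2], this density vanishes at the infinities and so encodes
    the restriction. *)
Let int_oppe a f : symmetric_density a -> measurable_fun setT f -> (forall z, 0 <= f z) ->
  (\int[a]_z (f (- z)%E * \1_finite_llr (- z)%E)%:E = \int[a]_z (f z * tilt z ^+ 2)%:E)%E.
Proof.
move=> sa mf f0.
have mo : measurable_fun setT (oppe : \bar R -> \bar R) by exact: oppe_measurable.
pose om := isMeasurableFun.Build _ _ _ _ _ mo.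
pose opp : {mfun \bar R >-> \bar R} := HB.pack (oppe : \bar R -> \bar R) om.
pose nu := distribution a opp.
pose mu := mrestr nu measurable_finite_llr.
have mt2 : measurable_fun setT (fun z : \bar R => tilt z ^+ 2).
  by apply: measurable_funX; exact: measurable_tilt.
transitivity (\int[mu]_z (f z)%:E)%E.
  rewrite (@ge0_integral_density _ _ _ mu nu (\1_finite_llr)); last 5 first.
  - exact: measurable_indic.
  - by [].
  - by move=> A mA; rewrite integral_indic// /mu /mrestr setIC.
  - exact/measurable_EFinP.
  - by move=> z; rewrite lee_fin.
  rewrite ge0_integral_distribution//.
  - apply: emeasurable_funM; first exact/measurable_EFinP.
    by apply/measurable_EFinP; exact: measurable_indic.
  - by move=> z; rewrite mule_ge0 ?lee_fin.
rewrite (@ge0_integral_density _ _ _ mu a (fun z => tilt z ^+ 2))//.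
- by move=> z; rewrite sqr_ge0.
- move=> A mA.
  have mA' : measurable (EFin @^-1` A).
    by rewrite -[X in measurable X]setTI; exact: EFin_measurable.
  transitivity (a [set (- z)%:E | z in EFin @^-1` A]).
    change (a ((oppe : \bar R -> \bar R) @^-1` (A `&` finite_llr)) =
      a [set (- z)%:E | z in EFin @^-1` A]); congr (a _).
    apply/seteqP; split => z /=.
      move=> [Az [r _ rz]]; exists r; first by rewrite /= rz.
      by rewrite EFinN rz oppeK.
    move=> [r Ar <-]; rewrite EFinN oppeK; split => //.
    by exists r.
  rewrite sa// [LHS]integral_mkcond [RHS]integral_mkcond; apply: eq_integral => z _.
  rewrite /patch; case: z => [r| |] /=.
  - rewrite (_ : (r%:E \in EFin @` (EFin @^-1` A)) = (r%:E \in A)).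
      by case: ifP => //; rewrite expr2 -expRD -opprD -splitr.
    apply/idP/idP => /set_mem; last by move=> Ar; apply/mem_set; exists r.
    by move=> [s As [<-]]; exact/mem_set.
  - rewrite ifF; first by rewrite expr0n /=; case: ifP.
    by apply/negP => /set_mem[].
  - rewrite ifF; first by rewrite expr0n /=; case: ifP.
    by apply/negP => /set_mem[].
- exact/measurable_EFinP.
Qed.

Lemma symmetric_density_symm a : is_density a -> symmetric_density a -> symm a.
Proof.
move=> da sa f mf f0.
have mt := @measurable_thalf R.
have tb z : -1 <= thalf z <= 1 by exact: thalf_bound.
have P0 z : 0 <= (1 + thalf z) / 2 by have := tb z; lra.
have Q0 z : 0 <= (1 - thalf z) / 2 by have := tb z; lra.
have mP : measurable_fun setT (fun z : \bar R => (1 + thalf z) / 2 * f z).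
  by apply: measurable_funM => //; apply: measurable_funM => //; exact: measurable_funD.
have mQ : measurable_fun setT (fun z : \bar R => (1 - thalf z) / 2 * f z).
  by apply: measurable_funM => //; apply: measurable_funM => //; exact: measurable_funB.
have mQN : measurable_fun setT (fun z : \bar R => (1 - thalf z) / 2 * f (- z)%E).
  apply: measurable_funM; first by apply: measurable_funM => //; exact: measurable_funB.
  by apply: measurableT_comp => //; exact: oppe_measurable.
have f0N z : 0 <= f (- z)%E by [].
transitivity (\int[a]_z ((1 + thalf z) / 2 * f z + (1 - thalf z) / 2 * f z)%:E)%E.
  by apply: eq_integral => z _; congr (_%:E); field.
rewrite /symz !ge0_eq_intD//; do ?by move=> z; rewrite mulr_ge0.
congr (_ + _)%E.
have g0 z : 0 <= (1 + thalf z) / 2 * f z by rewrite mulr_ge0.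
have := int_oppe sa mP g0 => e.
(* At -oo the weight (1 - tanh(z/2)) / 2 is 1; here it matters that a density does not charge this
   point. *)
have delNy (h : \bar R -> R) : measurable_fun setT h -> (forall z, 0 <= h z) ->
    (\int[a]_z (h z)%:E = \int[a]_(z in ~` [set -oo]) (h z)%:E)%E.
  move=> mh h0; rewrite (ge0_negligible_integral (N := [set -oo%E]))//.
  - by rewrite setTD.
  - exact/measurable_EFinP.
  - by move=> z _; rewrite lee_fin.
rewrite delNy//; last by move=> z; rewrite mulr_ge0.
rewrite [RHS]delNy//; last by move=> z; rewrite mulr_ge0.
transitivity (\int[a]_(z in ~` [set -oo%E]) ((1 + thalf z) / 2 * f z * tilt z ^+ 2)%:E)%E.
  apply: eq_integral => z /set_mem /= zN; congr (_%:E).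
  have h1 := thalf_tilt z; have h2 := thalf_tilt (- z)%E.
  case: z zN h1 h2 => [r| |] zN h1 h2; last 2 first.
  - by rewrite thalfy subrr mul0r mul0r /= expr0n mulr0.
  - by exfalso; exact: zN.
  rewrite sechN thalfN in h2.
  (* The weights of r and -r have ratio e^r, so multiplication by e^(-r) turns the weight of r into
     that of -r. *)
  have tt1 : tilt (- r%:E)%E * tilt r%:E = 1.
    by rewrite /= -expRD mulNr opprK subrr expR0.
  transitivity (((1 + thalf r%:E) / 2 * tilt r%:E) * (tilt r%:E * f r%:E)); last by ring.
  rewrite h1 -h2.
  transitivity ((1 - thalf r%:E) / 2 * (tilt (- r%:E)%E * tilt r%:E) * f r%:E); last by ring.
  by rewrite tt1 mulr1.
rewrite -[LHS]delNy; last 2 first.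
- by apply: measurable_funM; [exact: mP|apply: measurable_funX; exact: measurable_tilt].
- by move=> z; rewrite mulr_ge0// sqr_ge0.
rewrite -e delNy; last 2 first.
- apply: measurable_funM.
    by apply: (measurableT_comp (f := fun z => (1 + thalf z) / 2 * f z)) => //; exact: oppe_measurable.
  by apply: measurableT_comp => //.
- by move=> z; rewrite mulr_ge0.
apply: eq_integral => z /set_mem /= zN; congr (_%:E).
rewrite thalfN; case: z zN => [r| |] zN; last 2 first.
- by rewrite thalfy subrr !mul0r.
- by exfalso; exact: zN.
by rewrite indicE mem_set ?mulr1//; exists (- r).
Qed.

Lemma measurable_expeR : measurable_fun setT (@expeR R).
Proof.
rewrite (_ : expeR = fun z => match z with
    r%:E => (expR r)%:E | +oo%E => +oo%E | -oo%E => 0%E end); last first.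
  by apply/funext => -[].
by apply: measurable_case_ereal; apply/measurable_EFinP.
Qed.

Lemma tilt_le_expeR z : ((tilt z)%:E <= expeR (- (z * 2^-1%:E)))%E.
Proof.
by case: z => [r| |]; rewrite /= ?expeR_ge0.
Qed.

Lemma batta_le_bhattacharyya a : symm a -> ((batta a)%:E <= bhattacharyya a)%E.
Proof.
move=> sa; rewrite -int_tilt//; apply: ge0_le_integral => //.
- by move=> z _; rewrite lee_fin tilt_ge0.
- by apply/measurable_EFinP; exact: measurable_tilt.
- apply: measurableT_comp; first exact: measurable_expeR.
  by apply: measurableT_comp => //; exact: emeasurable_funM.
- by move=> z _; exact: tilt_le_expeR.
Qed.

(** The error indicator, with value 1/2 at 0, symmetrizes at finite z to (1 - |tanh(z/2)|) / 2,
    which is at most 1 / cosh(z/2). *)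
Lemma bit_error_rate_le a : symm a -> (bit_error_rate a <= (batta a)%:E)%E.
Proof.
move=> sa; rewrite -battaE.
pose f z : R := if (z < 0)%E then 1 else if z == 0%E then 2^-1 else 0.
have f0 z : 0 <= f z by rewrite /f; case: ifP => // _; case: ifP.
have mN : measurable [set z : \bar R | (z < 0)%E].
  rewrite (_ : [set z | _] = `]-oo, 0%E[%classic); first exact: emeasurable_itv.
  by apply/seteqP; split => z; rewrite /= in_itv.
have fE z : f z = \1_[set z | (z < 0)%E] z + 2^-1 * \1_[set 0%E] z.
  rewrite /f !indicE; case: ifPn => z0.
    rewrite mem_set// memNset ?mulr0 ?addr0//= => z0'.
    by move: z0; rewrite z0' ltxx.
  rewrite memNset ?add0r; last exact/negP.
  case: eqP => [->|z0']; first by rewrite mem_set ?mulr1.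
  by rewrite memNset ?mulr0.
have m1 : measurable_fun setT (\1_[set z : \bar R | (z < 0)%E] : \bar R -> R).
  exact: measurable_indic.
have m2 : measurable_fun setT (\1_[set 0%E : \bar R] : \bar R -> R).
  exact: measurable_indic.
have mf : measurable_fun setT f.
  rewrite (_ : f = fun z => \1_[set z | (z < 0)%E] z + 2^-1 * \1_[set 0%E] z); last exact/funext.
  by apply: measurable_funD => //; exact: measurable_funM.
have -> : bit_error_rate a = (\int[a]_z (f z)%:E)%E.
  under eq_integral do rewrite fE.
  rewrite ge0_eq_intD; [|exact: m1|exact: measurable_funM|by []|by move=> z; rewrite mulr_ge0].
  by rewrite ge0_eq_intZ// !integral_indic// !setIT.
rewrite sa//; apply: ge0_le_int.
- exact: measurable_symz.
- exact: measurable_sech.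
- exact: symz_ge0.
move=> [r| |]; rewrite /symz; last 2 first.
- by rewrite thalfy /f /= subrr !mul0r addr0 mulr0.
- by rewrite thalfNy /f /= subrr !mul0r add0r mulr0.
rewrite sechE thalfE /f /= !lte_fin oppr_lt0 !eqe oppr_eq0.
have := expR_gt0 (r / 2); have q1 := expR_gt1 (r / 2); have q2 := expR_lt1 (r / 2).
set q := expR (r / 2) => q0; rewrite -/q in q1 q2.
have Q0 : 0 < q ^+ 2 + 1 by nra.
have -> : 1 + (q ^+ 2 - 1) / (q ^+ 2 + 1) = 2 * q ^+ 2 / (q ^+ 2 + 1).
  by field; rewrite gt_eqF.
have -> : 1 - (q ^+ 2 - 1) / (q ^+ 2 + 1) = 2 / (q ^+ 2 + 1).
  by field; rewrite gt_eqF.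
case: (ltgtP r 0) => r0.
- rewrite mulr1 mulr0 addr0 mulrAC ler_pdivrMr// divfK ?gt_eqF//.
  have : q < 1 by rewrite q2; lra.
  by nra.
- rewrite mulr1 mulr0 add0r mulrAC ler_pdivrMr// divfK ?gt_eqF//.
  have : 1 < q by rewrite q1; lra.
  by nra.
- have -> : q = 1 by rewrite /q r0 mul0r expR0.
  by rewrite -subr_ge0 (_ : _ - _ = 2^-1); [rewrite invr_ge0|field].
Qed.

End symmetric_density.

(** * Bit channels *)

Section channel.
Context {R : realType} (C : @modulated_awgn R).
Implicit Types (i : 'I_(q C)) (a b : (q C).-tuple bool) (x : R) (f : \bar R -> R).

Let sigma_neq0 : sigma C != 0. Proof. by rewrite gt_eqF// sigma_gt0. Qed.

Lemma likelihood_gt0 a x : 0 < likelihood a x.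
Proof.
rewrite /likelihood normal_pdfE// mulr_gt0 ?expR_gt0//.
exact: normal_peak_gt0.
Qed.

Lemma measurable_likelihood a : measurable_fun setT (likelihood a).
Proof. exact: measurable_normal_pdf. Qed.

Definition bit_likelihood i (u : bool) x := \sum_(a | tnth a i == u) likelihood a x.

Lemma label_exists i (u : bool) : exists a, tnth a i == u.
Proof. by exists [tuple of nseq (q C) u]; rewrite tnth_nseq. Qed.

Lemma bit_likelihood_gt0 i u x : 0 < bit_likelihood i u x.
Proof.
have [a au] := label_exists i u.
rewrite /bit_likelihood (bigD1 a)//= ltr_pwDl ?likelihood_gt0//.
by apply: sumr_ge0 => b _; exact/ltW/likelihood_gt0.
Qed.

Lemma bit_llrE i x :
  bit_llr i x = ln (bit_likelihood i false x / bit_likelihood i true x).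
Proof.
rewrite /bit_llr /bit_likelihood; congr (ln (_ / _)); apply: eq_bigl => a.
  by case: (tnth a i).
by case: (tnth a i).
Qed.

(** tanh of half a log-likelihood ratio is the difference of the two posterior probabilities of the
    bit. *)
Lemma bit_llr_thalf i x :
  (bit_likelihood i false x + bit_likelihood i true x) * thalf (bit_llr i x)%:E =
  bit_likelihood i false x - bit_likelihood i true x.
Proof.
have F0 := bit_likelihood_gt0 i false x; have F1 := bit_likelihood_gt0 i true x.
rewrite thalfE /= bit_llrE; set F := bit_likelihood i false x.
set G := bit_likelihood i true x.
have -> : expR (ln (F / G) / 2) ^+ 2 = F / G.
  by rewrite expr2 -expRD -splitr lnK// posrE divr_gt0.
by field; rewrite !gt_eqF// addr_gt0.
Qed.

Lemma int_adapted i a f : measurable_fun setT f -> (forall z, 0 <= f z) ->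
  (\int[distribution (normal_prob (symb a) (sigma C)) (adapted_llr i a)]_z (f z)%:E =
   \int[lebesgue_measure]_x (f (adapted_llr i a x) * likelihood a x)%:E)%E.
Proof.
move=> mf f0; rewrite ge0_integral_distribution//; last exact/measurable_EFinP.
rewrite (@ge0_integral_density _ _ _ _ lebesgue_measure (likelihood a))//.
- exact: measurable_likelihood.
- by move=> x; exact/ltW/likelihood_gt0.
- by apply/measurable_EFinP; exact: (measurableT_comp mf (measurable_adapted_llr i a)).
- by move=> x; rewrite lee_fin.
Qed.

Lemma measurable_adapted_density i a f : measurable_fun setT f ->
  measurable_fun setT (fun x : measurableTypeR R => f (adapted_llr i a x) * likelihood a x).
Proof.
move=> mf; apply: measurable_funM; last exact: measurable_likelihood.
by apply: measurableT_comp => //; exact: measurable_adapted_llr.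
Qed.

Lemma int_bit_channel i f : measurable_fun setT f -> (forall z, 0 <= f z) ->
  (\int[bit_channel i]_z (f z)%:E = \int[lebesgue_measure]_x
    (#|{: (q C).-tuple bool}|%:R^-1 * (f (bit_llr i x)%:E * bit_likelihood i false x
       + f (- bit_llr i x)%:E * bit_likelihood i true x))%:E)%E.
Proof.
move=> mf f0; rewrite int_mixture//.
set c : R := #|{: (q C).-tuple bool}|%:R^-1.
have c0 : 0 <= c by rewrite invr_ge0.
under eq_bigr => a _.
  rewrite int_adapted// -ge0_eq_intZ//; last 2 first.
  - exact: measurable_adapted_density.
  - by move=> x; rewrite mulr_ge0// ltW// likelihood_gt0.
  over.
rewrite -ge0_integral_sum//; last 2 first.
- move=> a; apply/measurable_EFinP; apply: measurable_funM => //.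
  exact: measurable_adapted_density.
- by move=> a x _; rewrite lee_fin !mulr_ge0// ltW// likelihood_gt0.
apply: eq_integral => x _; rewrite sumEFin; congr (_%:E).
rewrite -mulr_sumr; congr (_ * _).
rewrite (bigID (fun a => tnth a i == false))/= /bit_likelihood !mulr_sumr.
congr (_ + _).
  by apply: eq_bigr => a /eqP ai; rewrite /adapted_llr ai expr0 mul1r.
apply: eq_big => a; first by case: (tnth a i).
by move=> ai; rewrite /adapted_llr (_ : tnth a i = true) ?expr1 ?mulN1r//; case: (tnth a i) ai.
Qed.

(** Symmetry holds separately at each received value x: the adapted LLR is v or -v with likelihoods
    F and G, and v = ln (F / G) gives F / (F + G) = (1 + tanh(v/2)) / 2. *)
Lemma symm_bit_channel i : symm (bit_channel i).
Proof.
move=> f mf f0; rewrite !int_bit_channel//; last 2 first.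
- exact: measurable_symz.
- exact: symz_ge0.
apply: eq_integral => x _; congr (_%:E); congr (_ * _).
rewrite /symz EFinN oppeK thalfN.
have := bit_llr_thalf i x.
set F := bit_likelihood i false x; set G := bit_likelihood i true x.
set v := (bit_llr i x)%:E => e.
transitivity ((F + G + (F + G) * thalf v) / 2 * f v + (F + G - (F + G) * thalf v) / 2 * f (- v)%E).
  by rewrite e; field.
by field.
Qed.

Lemma symm_mean_bit_channel : symm (mean_bit_channel C).
Proof. by apply: symm_mixture => i; exact: symm_bit_channel. Qed.

Lemma top_symbol : exists a, forall b, b != a -> symb b < symb a.
Proof.
have [a0 _] := label_exists (Ordinal (q_gt0 C)) true.
case: (arg_maxP (fun a => symb a) (isT : xpredT a0)) => a _ amax.
exists a => b ba; rewrite lt_neqAle; have /= -> := amax b isT.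
by rewrite andbT; apply: contra ba => /eqP/(@symb_inj _ C) ->.
Qed.

(** The logarithm of the ratio of two Gaussian densities of equal variance is affine in x, with
    positive slope here; the threshold is the point where it reaches k. *)
Lemma likelihood_dominated a b (k : R) : symb b < symb a -> exists Y : R,
  forall x, Y <= x -> likelihood b x <= expR (- k) * likelihood a x.
Proof.
move=> ba; pose D := sigma C ^+ 2 *+ 2.
have D0 : 0 < D by rewrite mulrn_wgt0// exprn_gt0// sigma_gt0.
have d0 : 0 < symb a - symb b by rewrite subr_gt0.
exists (k * D / (symb a - symb b) / 2 + (symb a + symb b) / 2) => x xY.
rewrite /likelihood !normal_pdfE// mulrCA ler_wpM2l ?normal_peak_ge0//.
rewrite /normal_fun -/D -expRD ler_expR.
have e : k * D / (symb a - symb b) * (symb a - symb b) = k * D by rewrite divfK ?gt_eqF.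
have h : k * D <= (symb a - symb b) * (2 * x - symb a - symb b).
  by rewrite -e mulrC ler_wpM2l ?(ltW d0)//; lra.
have {}D0 : 0 < D by []; clearbody D.
have -> : - k + - (x - symb a) ^+ 2 / D = (- (k * D) - (x - symb a) ^+ 2) / D.
  by field; rewrite gt_eqF.
by rewrite ler_wpM2r ?invr_ge0 ?(ltW D0)//; nra.
Qed.

(* Far out on the real line the likelihood of the largest symbol dominates the
   sum of all the others. *)
Lemma bit_llr_far i : exists Y : R, forall x, Y <= x -> 1 <= `|bit_llr i x|.
Proof.
have [a amax] := top_symbol.
pose n := #|{: (q C).-tuple bool}|.
(* The exponent 1 + n is chosen because n e^(-(1 + n)) <= e^(-1): all the other symbols together
   still lose a factor e. *)
have hY b : exists Y : R, b != a -> forall x, Y <= x ->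
    likelihood b x <= expR (- (1 + n%:R)) * likelihood a x.
  have [->|ba] := eqVneq b a; first by exists 0.
  by have [Y hY] := likelihood_dominated (1 + n%:R) (amax b ba); exists Y.
have [Y {}hY] := choice hY.
(* This sum dominates each of the thresholds. *)
exists (\sum_b `|Y b|) => x xY.
have Yx b : Y b <= x.
  apply: le_trans xY; apply: (le_trans (ler_norm _)).
  by rewrite (bigD1 b)//= lerDl; apply: sumr_ge0.
have small (u : bool) : u != tnth a i ->
    bit_likelihood i u x <= expR (- 1) * bit_likelihood i (~~ u) x.
  move=> ua; apply: (@le_trans _ _ (expR (- 1) * likelihood a x)); last first.
    rewrite ler_wpM2l ?expR_ge0// /bit_likelihood (bigD1 a)/=; last first.
      by move: ua; case: u; case: (tnth a i).
    by rewrite lerDl; apply: sumr_ge0 => b _; exact/ltW/likelihood_gt0.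
  apply: (@le_trans _ _ (\sum_(b | tnth b i == u) expR (- (1 + n%:R)) * likelihood a x)).
    apply: ler_sum => b bu; apply: hY => //.
    by apply: contraNneq ua => <-; rewrite (eqP bu).
  apply: (@le_trans _ _ (\sum_(b : (q C).-tuple bool) expR (- (1 + n%:R)) * likelihood a x)).
    rewrite [leRHS](bigID (fun b : (q C).-tuple bool => tnth b i == u))/= lerDl; apply: sumr_ge0 => b _.
    by rewrite mulr_ge0 ?expR_ge0// ltW// likelihood_gt0.
  rewrite sumr_const -/n -mulrnAl ler_wpM2r//; first exact/ltW/likelihood_gt0.
  rewrite opprD expRD -mulrnAr ler_piMr ?expR_ge0// -mulr_natr.
  rewrite expRN mulrC ler_pdivrMr ?expR_gt0// mul1r.
  by have := expR_ge1Dx (n%:R : R); lra.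
have F0 := bit_likelihood_gt0 i false x; have F1 := bit_likelihood_gt0 i true x.
rewrite bit_llrE; case E : (tnth a i).
  have := small false; rewrite E => /(_ isT) h.
  rewrite ler_normr; apply/orP; right.
  rewrite lerNr -(expRK (-1)) ler_ln ?posrE ?divr_gt0 ?expR_gt0//.
  by rewrite ler_pdivrMr.
have := small true; rewrite E => /(_ isT) h.
rewrite ler_normr; apply/orP; left.
rewrite -[leLHS](expRK 1) ler_ln ?posrE ?divr_gt0 ?expR_gt0//.
rewrite ler_pdivlMr//; move: h; rewrite expRN mulrC ler_pdivlMr ?expR_gt0//.
by rewrite mulrC.
Qed.

Lemma far_mass_mean_bit_channel : 0 < far_mass (mean_bit_channel C) 1.
Proof.
rewrite -lte_fin -far_massE.
have mf := @measurable_sech_far R 1.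
have f0 (w : \bar R) : 0 <= sech w * far 1 w by have /andP[] := sech_far_bound 1 w.
pose i : 'I_(q C) := Ordinal (q_gt0 C).
rewrite int_mixture//.
rewrite (bigD1_seq i) ?mem_index_enum ?index_enum_uniq//=.
apply: lt_le_trans (leeDl _ _); last first.
  apply: sume_ge0 => j _; rewrite mule_ge0 ?lee_fin ?invr_ge0//.
  by apply: integral_ge0 => z _; rewrite lee_fin.
rewrite mule_gt0 ?lte_fin ?invr_gt0 ?ltr0n ?card_levels_gt0//.
have [Y hY] := bit_llr_far i.
rewrite int_bit_channel//.
set c : R := #|{: (q C).-tuple bool}|%:R^-1.
have c0 : 0 < c by rewrite invr_gt0 ltr0n card_labels_gt0.
pose h (w : \bar R) := sech w * far 1 w.
pose g x := c * (h (bit_llr i x)%:E * bit_likelihood i false x +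
  h (- bit_llr i x)%:E * bit_likelihood i true x).
change (0 < \int[lebesgue_measure]_x (g x)%:E)%E.
have mbl u : measurable_fun setT (bit_likelihood i u).
  rewrite /bit_likelihood; under eq_fun do rewrite big_mkcond.
  by apply: measurable_sum => a; case: (tnth a i == u) => //; exact: measurable_likelihood.
have mv : measurable_fun setT (bit_llr i : R -> R).
  apply: (eq_measurable_fun (fun x => ln (bit_likelihood i false x / bit_likelihood i true x))).
    by move=> x _; rewrite bit_llrE.
  apply: measurableT_comp => //; apply: measurable_funM => //.
  by apply: (measurableT_comp (f := @GRing.inv R)) => //; exact: measurable_invr.
have mg : measurable_fun setT g.
  apply: measurable_funM => //; apply: measurable_funD; apply: measurable_funM => //.
    apply: (measurableT_comp mf) => //.
    by apply/measurable_EFinP.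
  apply: (measurableT_comp mf) => //.
  by apply/measurable_EFinP; exact: measurableT_comp.
have g0 x : 0 <= g x.
  by rewrite mulr_ge0 ?(ltW c0)// addr_ge0// mulr_ge0 ?f0// ltW// bit_likelihood_gt0.
have gpos x : Y <= x -> 0 < g x.
  move=> /hY v1; rewrite mulr_gt0// ltr_pwDl//.
    rewrite mulr_gt0 ?bit_likelihood_gt0// /h /far v1 mulr1 sechE /=.
    by have := expR_gt0 (bit_llr i x / 2) => q0; rewrite divr_gt0//; nra.
  by rewrite mulr_ge0 ?f0// ltW// bit_likelihood_gt0.
rewrite lt_neqAle integral_ge0 ?andbT; last by move=> x _; rewrite lee_fin.
apply/eqP => /esym int0.
have mEg : measurable_fun setT (EFin \o g) by exact/measurable_EFinP.
have abs0 : (\int[lebesgue_measure]_x `|(EFin \o g) x| = 0)%E.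
  by rewrite -[RHS]int0; apply: eq_integral => x _ /=; rewrite ger0_norm.
have [N [mN N0 hN]] := (ae_eq_integral_abs lebesgue_measure measurableT mEg).1 abs0.
(* The integrand is positive on [Y, +oo[; a zero integral would place an interval of length 1 in a
   null set. *)
have : (lebesgue_measure `[Y, (Y + 1)%R]%classic <= lebesgue_measure N)%E.
  apply: le_measure; rewrite ?inE//.
  move=> x; rewrite /= in_itv /= => /andP[Yx _]; apply: hN => /= h'.
  by have := gpos x Yx; have [->] := h' I; rewrite ltxx.
rewrite N0 lebesgue_measure_itv /= lte_fin ltrDl ltr01 -EFinB lee_fin.
by rewrite addrAC subrr add0r ler10.
Qed.

Lemma batta_mean_le : ((batta (mean_bit_channel C))%:E <= mean_bhattacharyya C)%E.
Proof.
rewrite /mean_bhattacharyya -battaE int_mixture//; last 2 first.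
- exact: measurable_sech.
- exact: sech_ge0.
rewrite card_ord ge0_sume_distrr; last first.
  move=> i _; apply: integral_ge0 => z _; exact: expeR_ge0.
apply: lee_sum => i _; rewrite lee_wpmul2l ?lee_fin ?invr_ge0//.
by rewrite battaE; apply: batta_le_bhattacharyya; exact: symm_bit_channel.
Qed.

End channel.

Lemma ler_expe (R : realType) (r : R) (x : \bar R) n : 0 <= r -> (r%:E <= x)%E ->
  ((r ^+ n)%:E <= x ^+ n)%E.
Proof.
move=> r0 rx; elim: n => [|n ih]; first by rewrite expr0 expe0.
by rewrite exprS EFinM expeS lee_pmul ?lee_fin ?exprn_ge0.
Qed.

Theorem theorem1 (R : realType) (C : @modulated_awgn R) (E : @core_ensemble R) :
  (\sum_(1 <= j < (jmax E).+1)
     (lambda E 2 j)%:E * mean_bhattacharyya C ^+ j * ((rho1 E)^`().[1])%:E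
   <= 1)%E ->
  exists2 eps : R, 0 < eps &
    forall a : probability (\bar R) R,
      is_density a -> symmetric_density a ->
      (bhattacharyya a <= eps%:E)%E ->
      bit_error_rate (core_density_evolution E (mean_bit_channel C) a l)
        @[l --> \oo] --> 0%E.
Proof.
move=> stableE.
have sb := symm_mean_bit_channel C.
(* The stability sum is nondecreasing in y_2, so it may be evaluated at the real number [batta],
   which is at most the mean Bhattacharyya constant. *)
have stable : lambda2 E (batta (mean_bit_channel C)) * chk_slope E <= 1.
  rewrite -lee_fin; apply: le_trans stableE.
  rewrite /lambda2 mulr_suml -sumEFin; apply: lee_sum => j _.
  rewrite EFinM lee_wpmul2r ?lee_fin ?(le_trans ler01 (chk_slope_ge1 E))//.
  rewrite EFinM lee_wpmul2l ?lee_fin ?(lambda_ge0 E (2, j))//.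
  by apply: ler_expe; [exact: batta_ge0|exact: batta_mean_le].
have [eps eps0 heps] := core_evolution_vanishes sb stable ltr01 (far_mass_mean_bit_channel C).
exists eps => // a da sda Ba.
have sa := symmetric_density_symm da sda.
have xa : batta a <= eps.
  by rewrite -lee_fin; exact: le_trans (batta_le_bhattacharyya sa) Ba.
have sl l : symm (core_density_evolution E (mean_bit_channel C) a l).
  by elim: l => // l ih; apply: symm_var_update => //; exact: symm_chk_update.
apply: (@squeeze_cvge _ _ _ _ (cst 0%E) _
  (fun l => (batta (core_density_evolution E (mean_bit_channel C) a l))%:E)).
- apply: nearW => l; rewrite bit_error_rate_le// andbT.
  by rewrite adde_ge0// mule_ge0// lee_fin.
- exact: cvg_cst.
apply: cvg_EFin; first exact: nearW.
apply/cvgrPdist_le => delta delta0.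
have [N hN] := heps a sa xa delta delta0.
exists N => // l /= Nl.
by rewrite sub0r normrN ger0_norm ?batta_ge0//; exact: hN.
Qed.
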